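(* $\mathcal A_{sp(\infty)}\simeq\mathcal A_{o(\infty)}$ as algebras.
   Context: The ground field is $\mathbb C$. For $\mathfrak g=o(\infty)=\varinjlim o(n)$ or $\mathfrak g=sp(\infty)=\varinjlim sp(2n)$ (left upper corner inclusions), $V$ is the natural representation of $\mathfrak g$ (direct limit of the natural representations of the finite-dimensional algebras), $T^p:=V^{\otimes p}$ and $T^{\leq r}:=\bigoplus_{p\leq r}T^p$. Put $\mathcal A_{\mathfrak g}^r:=\operatorname{End}_{\mathfrak g}T^{\leq r}$ (a finite-dimensional algebra) and $\mathcal A_{\mathfrak g}:=\varinjlim\mathcal A_{\mathfrak g}^r$, where $\mathcal A_{\mathfrak g}^r\hookrightarrow\mathcal A_{\mathfrak g}^{r+1}$ is extension by zero on the summand $T^{r+1}$. *)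

(* Defs.v *)
From HB Require Import structures.
From mathcomp Require Import all_boot all_order all_algebra generic_quotient.
From mathcomp Require Import boolp classical_sets functions reals complex.
From mathcomp Require Import finmap monalg.

Set Implicit Arguments.
Unset Strict Implicit.
Unset Printing Implicit Defensive.

Import GRing.Theory.

Local Open Scope ring_scope.
Local Open Scope quotient_scope.

(* Associative algebras over a field, not necessarily unital (the direct      *)
(* limits considered below have no unit), and their homomorphisms.            *)

Record assocAlg (K : fieldType) := AssocAlg {
  alg_sort :> lmodType K;
  alg_mul : alg_sort -> alg_sort -> alg_sort;
  alg_mulA : associative alg_mul;
  alg_mulDl : left_distributive alg_mul +%R;
  alg_mulDr : right_distributive alg_mul +%R;
  alg_scaleAl : forall (c : K) x y, c *: alg_mul x y = alg_mul (c *: x) y;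
  alg_scaleAr : forall (c : K) x y, c *: alg_mul x y = alg_mul x (c *: y)
}.

Definition alg_hom (K : fieldType) (A B : assocAlg K) (f : A -> B) : Prop :=
  linear f /\ {morph f : x y / alg_mul x y >-> alg_mul x y}.

Definition alg_iso (K : fieldType) (A B : assocAlg K) : Prop :=
  exists f : A -> B, alg_hom f /\ bijective f.

(* Direct systems indexed by (nat, <=). The maps [ds_map n m] are total in n  *)
(* and m, but only those with n <= m are constrained and used.                *)

Record dirSys (K : fieldType) := DirSys {
  ds_obj :> nat -> assocAlg K;
  ds_map : forall n m, ds_obj n -> ds_obj m;
  ds_hom : forall n m, (n <= m)%N -> alg_hom (@ds_map n m);
  ds_id : forall n x, @ds_map n n x = x;
  ds_comp : forall n m k, (n <= m)%N -> (m <= k)%N ->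
    forall x, @ds_map m k (@ds_map n m x) = @ds_map n k x
}.

Arguments ds_map {K} d n m x.

Section DirLim.
Variables (K : fieldType) (D : dirSys K).

Definition dl_pre : Type := {n : nat & D n}.
HB.instance Definition _ := Choice.copy dl_pre {n : nat & D n}.

Definition dl_eqv (x y : dl_pre) : bool :=
  `[< exists k, [/\ (tag x <= k)%N, (tag y <= k)%N &
        ds_map D (tag x) k (tagged x) = ds_map D (tag y) k (tagged y)] >].

Lemma dl_eqv_refl : reflexive dl_eqv.
Proof. by move=> x; apply/asboolP; exists (tag x). Qed.

Lemma dl_eqv_sym : symmetric dl_eqv.
Proof.
by move=> x y; apply/asboolP/asboolP => -[k [h1 h2 e]]; exists k; split.
Qed.

Lemma dl_eqv_trans : transitive dl_eqv.
Proof.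
move=> y x z /asboolP[k [xk yk e1]] /asboolP[l [yl zl e2]].
apply/asboolP; exists (maxn k l).
have kM := leq_maxl k l; have lM := leq_maxr k l.
split; [exact: leq_trans kM | exact: leq_trans lM |].
by rewrite -(ds_comp xk kM) e1 (ds_comp yk kM) -(ds_comp zl lM) -e2 ds_comp.
Qed.

Canonical dl_equiv := EquivRel dl_eqv dl_eqv_refl dl_eqv_sym dl_eqv_trans.

Definition dirlim : Type := {eq_quot dl_equiv}.
HB.instance Definition _ := Choice.copy dirlim {eq_quot dl_equiv}.

Definition dl_in (n : nat) (a : D n) : dirlim :=
  \pi_({eq_quot dl_equiv}) (Tagged (fun n => D n : Type) a : dl_pre).

Lemma dl_in_eq n m (a : D n) (b : D m) :
  dl_in a = dl_in b <->
  exists k, [/\ (n <= k)%N, (m <= k)%N & ds_map D n k a = ds_map D m k b].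
Proof.
split=> [/eqmodP/asboolP //|h]; apply/eqmodP; exact/asboolP.
Qed.

Lemma dl_in_map n m (a : D n) : (n <= m)%N -> dl_in (ds_map D n m a) = dl_in a.
Proof. by move=> nm; apply/dl_in_eq; exists m; split=> //; rewrite ds_id. Qed.

Lemma dl_in_surj (x : dirlim) : exists n (a : D n), x = dl_in a.
Proof.
exists (tag (repr x)), (tagged (repr x)).
by rewrite /dl_in; case: (repr x) (reprK x).
Qed.

Definition dl_lift (N : nat) (x : dirlim) : D N :=
  ds_map D (tag (repr x)) N (tagged (repr x)).

Definition dl_level2 (x y : dirlim) : nat := maxn (tag (repr x)) (tag (repr y)).

Lemma dl_liftK N x : (tag (repr x) <= N)%N -> dl_in (dl_lift N x) = x.
Proof.
move=> h; rewrite dl_in_map //.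
by rewrite /dl_in; case: (repr x) (reprK x).
Qed.

Definition dl_op2 (op : forall n, D n -> D n -> D n) (x y : dirlim) : dirlim :=
  let N := dl_level2 x y in dl_in (op N (dl_lift N x) (dl_lift N y)).

Definition dl_op1 (op : forall n, D n -> D n) (x : dirlim) : dirlim :=
  let N := tag (repr x) in dl_in (op N (dl_lift N x)).

Lemma dl_op2E (op : forall n, D n -> D n -> D n) :
  (forall n m, (n <= m)%N ->
     {morph ds_map D n m : a b / op n a b >-> op m a b}) ->
  forall n (a b : D n), dl_op2 op (dl_in a) (dl_in b) = dl_in (op n a b).
Proof.
move=> opM n a b; rewrite /dl_op2; set N := dl_level2 _ _.
have /dl_in_eq[k [h1 h2 e1]] : dl_in (dl_lift N (dl_in a)) = dl_in a.
  by apply: dl_liftK; exact: leq_maxl.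
have /dl_in_eq[l [h3 h4 e2]] : dl_in (dl_lift N (dl_in b)) = dl_in b.
  by apply: dl_liftK; exact: leq_maxr.
apply/dl_in_eq; exists (maxn k l).
have kM := leq_maxl k l; have lM := leq_maxr k l.
have NM := leq_trans h1 kM; have nM := leq_trans h2 kM.
split=> //; rewrite !opM //.
by rewrite -(ds_comp h1 kM) e1 (ds_comp h2 kM) -(ds_comp h3 lM) e2 ds_comp.
Qed.

Lemma dl_op1E (op : forall n, D n -> D n) :
  (forall n m, (n <= m)%N -> {morph ds_map D n m : a / op n a >-> op m a}) ->
  forall n (a : D n), dl_op1 op (dl_in a) = dl_in (op n a).
Proof.
move=> opM n a; rewrite /dl_op1; set N := tag _.
have /dl_in_eq[k [h1 h2 e1]] : dl_in (dl_lift N (dl_in a)) = dl_in a.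
  exact: dl_liftK.
by apply/dl_in_eq; exists k; split=> //; rewrite !opM // e1.
Qed.

Lemma dl_common3 (x y z : dirlim) :
  exists n (a b c : D n), [/\ x = dl_in a, y = dl_in b & z = dl_in c].
Proof.
have [n [a ->]] := dl_in_surj x; have [m [b ->]] := dl_in_surj y.
have [k [c ->]] := dl_in_surj z.
pose N := maxn n (maxn m k).
exists N, (ds_map D n N a), (ds_map D m N b), (ds_map D k N c).
by rewrite !dl_in_map // /N !leq_max leqnn ?orbT.
Qed.

Lemma dl_common2 (x y : dirlim) :
  exists n (a b : D n), x = dl_in a /\ y = dl_in b.
Proof. by have [n [a [b [_ [-> -> _]]]]] := dl_common3 x y y; exists n, a, b. Qed.

Lemma ds_mapD n m : (n <= m)%N -> {morph ds_map D n m : a b / a + b}.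
Proof.
by move=> nm a b; have [h _] := ds_hom D nm; have := h 1 a b; rewrite !scale1r.
Qed.

Lemma ds_map0 n m : (n <= m)%N -> ds_map D n m 0 = 0.
Proof.
move=> nm; apply: (addrI (ds_map D n m 0)).
by rewrite -ds_mapD // !addr0.
Qed.

Lemma ds_mapZ n m (c : K) : (n <= m)%N -> {morph ds_map D n m : a / c *: a}.
Proof.
move=> nm a; have [h _] := ds_hom D nm; have := h c a 0.
by rewrite addr0 ds_map0 // addr0.
Qed.

Lemma ds_mapN n m : (n <= m)%N -> {morph ds_map D n m : a / - a}.
Proof. by move=> nm a; rewrite -scaleN1r ds_mapZ // scaleN1r. Qed.

Lemma ds_mapM n m : (n <= m)%N ->
  {morph ds_map D n m : a b / alg_mul a b >-> alg_mul a b}.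
Proof. by move=> nm; have [] := ds_hom D nm. Qed.

Definition dl_zero : dirlim := dl_in (0 : D 0%N).
Definition dl_opp := dl_op1 (fun n => -%R : D n -> D n).
Definition dl_add := dl_op2 (fun n => +%R : D n -> D n -> D n).
Definition dl_scale (c : K) := dl_op1 (fun n => *:%R c : D n -> D n).
Definition dl_mul := dl_op2 (fun n => @alg_mul K (D n)).

Lemma dl_zeroE n : dl_zero = dl_in (0 : D n).
Proof. by apply/dl_in_eq; exists n; split; rewrite ?ds_map0. Qed.
Let oppE n (a : D n) : dl_opp (dl_in a) = dl_in (- a).
Proof. by apply: (@dl_op1E (fun n => -%R : D n -> D n)) => *; exact: ds_mapN. Qed.
Let addE n (a b : D n) : dl_add (dl_in a) (dl_in b) = dl_in (a + b).
Proof.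
by apply: (@dl_op2E (fun n => +%R : D n -> D n -> D n)) => *; exact: ds_mapD.
Qed.
Let scaleE (c : K) n (a : D n) : dl_scale c (dl_in a) = dl_in (c *: a).
Proof.
by apply: (@dl_op1E (fun n => *:%R c : D n -> D n)) => *; exact: ds_mapZ.
Qed.
Let mulE n (a b : D n) : dl_mul (dl_in a) (dl_in b) = dl_in (alg_mul a b).
Proof. by apply: (@dl_op2E (fun n => @alg_mul K (D n))) => *; exact: ds_mapM. Qed.

Let addA : associative dl_add.
Proof.
move=> x y z; have [n [a [b [c [-> -> ->]]]]] := dl_common3 x y z.
by rewrite !addE addrA.
Qed.
Let addC : commutative dl_add.
Proof.
by move=> x y; have [n [a [b [-> ->]]]] := dl_common2 x y; rewrite !addE addrC.
Qed.
Let add0 : left_id dl_zero dl_add.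
Proof.
by move=> x; have [n [a ->]] := dl_in_surj x; rewrite (dl_zeroE n) addE add0r.
Qed.
Let addN : left_inverse dl_zero dl_opp dl_add.
Proof.
move=> x; have [n [a ->]] := dl_in_surj x.
by rewrite (dl_zeroE n) oppE addE addNr.
Qed.
HB.instance Definition _ := GRing.isZmodule.Build dirlim addA addC add0 addN.

Let in_add n (a b : D n) : dl_in a + dl_in b = dl_in (a + b).
Proof. exact: addE. Qed.

Let scaleA (c d : K) x : dl_scale c (dl_scale d x) = dl_scale (c * d) x.
Proof. by have [n [a ->]] := dl_in_surj x; rewrite !scaleE scalerA. Qed.
Let scale1 : left_id 1 dl_scale.
Proof. by move=> x; have [n [a ->]] := dl_in_surj x; rewrite scaleE scale1r. Qed.
Let scaleDr : right_distributive dl_scale +%R.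
Proof.
move=> c x y; have [n [a [b [-> ->]]]] := dl_common2 x y.
by rewrite !(in_add, scaleE) scalerDr.
Qed.
Let scaleDl x : {morph dl_scale^~ x : c d / c + d}.
Proof.
move=> c d; have [n [a ->]] := dl_in_surj x.
by rewrite !(in_add, scaleE) scalerDl.
Qed.
HB.instance Definition _ :=
  GRing.Zmodule_isLmodule.Build K dirlim scaleA scale1 scaleDr scaleDl.

Let in_scale (c : K) n (a : D n) : c *: dl_in a = dl_in (c *: a).
Proof. exact: scaleE. Qed.

Let mulA : associative dl_mul.
Proof.
move=> x y z; have [n [a [b [c [-> -> ->]]]]] := dl_common3 x y z.
by rewrite !mulE alg_mulA.
Qed.
Let mulDl : left_distributive dl_mul +%R.
Proof.
move=> x y z; have [n [a [b [c [-> -> ->]]]]] := dl_common3 x y z.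
by rewrite !(in_add, mulE) alg_mulDl.
Qed.
Let mulDr : right_distributive dl_mul +%R.
Proof.
move=> x y z; have [n [a [b [c [-> -> ->]]]]] := dl_common3 x y z.
by rewrite !(in_add, mulE) alg_mulDr.
Qed.
Let scaleAl (c : K) x y : c *: dl_mul x y = dl_mul (c *: x) y.
Proof.
have [n [a [b [-> ->]]]] := dl_common2 x y.
by rewrite !(in_scale, mulE) alg_scaleAl.
Qed.
Let scaleAr (c : K) x y : c *: dl_mul x y = dl_mul x (c *: y).
Proof.
have [n [a [b [-> ->]]]] := dl_common2 x y.
by rewrite !(in_scale, mulE) alg_scaleAr.
Qed.

Definition dirlim_alg : assocAlg K :=
  AssocAlg mulA mulDl mulDr scaleAl scaleAr.

Lemma dl_in_hom n : @alg_hom K (D n) dirlim_alg (@dl_in n).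
Proof.
split=> [c a b|a b]; last by rewrite -mulE.
by rewrite in_scale in_add.
Qed.

End DirLim.

(* Vector spaces with a basis indexed by [I] are modelled by {malg K[I]}.     *)

Section LinearExtension.
Variables (K : fieldType) (I : choiceType) (W : lmodType K) (f : I -> W).

Definition lext (g : {malg K[I]}) : W := \sum_(k <- msupp g) g@_k *: f k.

Lemma lextEw (d : {fset I}) g :
  (msupp g `<=` d)%fset -> lext g = \sum_(k <- d) g@_k *: f k.
Proof.
move=> le; rewrite /lext (big_fset_incl _ le) // => k _ /mcoeff_outdom ->.
by rewrite scale0r.
Qed.

Lemma lext_is_linear : linear lext.
Proof.
move=> c g h; pose d := (msupp g `|` msupp h `|` msupp (c *: g + h))%fset.
have [gd hd cd] : [/\ msupp g `<=` d, msupp h `<=` d &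
    msupp (c *: g + h) `<=` d]%fset.
  by split; apply/fsubsetP => k kd; rewrite !inE kd ?orbT.
rewrite (lextEw gd) (lextEw hd) (lextEw cd).
rewrite scaler_sumr -big_split /=; apply: eq_bigr => k _.
by rewrite mcoeffD mcoeffZ scalerDl scalerA.
Qed.

HB.instance Definition _ :=
  GRing.isLinear.Build K {malg K[I]} W *:%R lext lext_is_linear.

Lemma lextU k : lext << k >> = f k.
Proof.
by rewrite (@lextEw [fset k]%fset) ?msuppU_le // big_seq_fset1 mcoeffUU scale1r.
Qed.

Lemma lextE g : lext g = \sum_(k <- msupp g) g@_k *: f k.
Proof. by []. Qed.

End LinearExtension.

#[local] Opaque lext.

Lemma malg_basisE (K : fieldType) (I : choiceType) (g : {malg K[I]}) :
  g = \sum_(k <- msupp g) g@_k *: << k >>.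
Proof.
rewrite [LHS]monalgE; apply: eq_bigr => k _; apply/malgP => i.
by rewrite mcoeffZ !mcoeffU mulrnAr mulr1.
Qed.

Lemma malg_ind (K : fieldType) (I : choiceType) (P : {malg K[I]} -> Prop) :
  P 0 -> (forall k, P << k >>) ->
  (forall c g h, P g -> P h -> P (c *: g + h)) -> forall g, P g.
Proof.
move=> P0 P1 PL g; rewrite (malg_basisE g).
by elim/big_rec: _ => // k h _ Ph; apply: PL.
Qed.

Lemma malg_linP (K : fieldType) (I : choiceType) (W : lmodType K)
    (f h : {linear {malg K[I]} -> W}) :
  (forall k, f << k >> = h << k >>) -> f =1 h.
Proof.
move=> e g; elim/malg_ind: g => [||c g1 g2 e1 e2]; rewrite ?linear0 ?e //.
by rewrite !linearP e1 e2.
Qed.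

Lemma mcoeff_lext (K : fieldType) (I J : choiceType) (f : I -> {malg K[J]})
    (g : {malg K[I]}) j :
  (lext f g)@_j = \sum_(k <- msupp g) g@_k * (f k)@_j.
Proof.
by rewrite lextE raddf_sum; apply: eq_bigr => k _; rewrite /= mcoeffZ.
Qed.

Section TensorModules.
Variable K : fieldType.

(* gl(oo): matrices (X_ij), i, j in nat, with finitely many nonzero entries;  *)
(* [ulc A] is A placed in the upper left corner.                              *)

Definition glinf := {malg K[(nat * nat)%type]}.

Definition ulc (n : nat) (A : 'M[K]_n) : glinf :=
  \sum_(i < n) \sum_(j < n) << A i j *g (val i, val j) >>.

(* o(n), for the standard symmetric form, and o(oo) *)
Definition o_fin (n : nat) (A : 'M[K]_n) : Prop := A^T = - A.

Definition o_inf (X : glinf) : Prop :=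
  exists n (A : 'M[K]_n), o_fin A /\ X = ulc A.

(* sp(2n), for the block diagonal form with blocks ((0, 1), (-1, 0)): this    *)
(* form on K^(2n) restricts from K^(2n+2), as the corner inclusions require.  *)
Definition symp_mx (m : nat) : 'M[K]_m :=
  \matrix_(i, j) (if ~~ odd i && (j == i.+1 :> nat) then 1
                  else if odd i && (i == j.+1 :> nat) then -1 else 0).

Definition sp_fin (n : nat) (A : 'M[K]_(n.*2)) : Prop :=
  A^T *m symp_mx n.*2 + symp_mx n.*2 *m A = 0.

Definition sp_inf (X : glinf) : Prop :=
  exists n (A : 'M[K]_(n.*2)), sp_fin A /\ X = ulc A.

(* The natural representation V, with basis e_i = << i >>, i in nat, and the  *)
(* tensor algebra T(V) = \bigoplus_p V^{\otimes p}, with basis << w >>, w a   *)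
(* word in nat: the word w of length p stands for the tensor                  *)
(* e_{w_0} \otimes ... \otimes e_{w_(p-1)}, so that [tens] is concatenation   *)
(* on basis elements. An element X of gl(oo) acts on T(V) by the Leibniz      *)
(* rule.                                                                      *)

Definition natV := {malg K[nat]}.

Definition natact (X : glinf) : natV -> natV :=
  lext (fun j => \sum_(p <- msupp X | p.2 == j) X@_p *: << p.1 >>).

Definition tensV := {malg K[seq nat]}.

Definition tens (s t : tensV) : tensV :=
  lext (fun u => lext (fun w => << u ++ w >> : tensV) t) s.

Definition inV : natV -> tensV := lext (fun i => << [:: i] >>).

Definition act_word (X : glinf) (w : seq nat) : tensV :=
  \sum_(k < size w)
     tens (tens << take k w >> (inV (natact X << nth 0%N w k >>)))
       << drop k.+1 w >>.

Definition act (X : glinf) : tensV -> tensV := lext (act_word X).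

HB.instance Definition _ X := GRing.Linear.copy (natact X) (lext _).
HB.instance Definition _ := GRing.Linear.copy inV (lext _).
HB.instance Definition _ X := GRing.Linear.copy (act X) (lext _).

(* V^{\otimes p} and T^{<= r} = \bigoplus_(p <= r) V^{\otimes p} inside T(V)  *)

Definition homog (p : nat) : {pred tensV} :=
  [pred t | all (fun w => size w == p) (msupp t)].

Definition tle_pred (r : nat) : {pred tensV} :=
  [pred t | all (fun w => (size w <= r)%N) (msupp t)].

Lemma tleP r (t : tensV) :
  reflect (forall w, (r < size w)%N -> t@_w = 0) (t \in tle_pred r).
Proof.
apply: (iffP allP) => h w.
- case: (msuppP t w) => // /h; rewrite leqNgt => /negbTE -> //.
- by rewrite leqNgt -mcoeff_neq0; apply: contraNN => /h ->.
Qed.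

Lemma homogP p (t : tensV) :
  reflect (forall w, size w != p -> t@_w = 0) (t \in homog p).
Proof.
apply: (iffP allP) => h w.
- by case: (msuppP t w) => // /h ->.
- by rewrite -mcoeff_neq0; apply: contraNT => /h ->.
Qed.

Lemma homog_submod p : submod_closed (homog p).
Proof.
split=> [|c t u /homogP ht /homogP hu]; apply/homogP => w hw.
  exact: mcoeff0.
by rewrite mcoeffD mcoeffZ ht // hu // mulr0 addr0.
Qed.

HB.instance Definition _ p :=
  GRing.isSubmodClosed.Build K tensV (homog p) (homog_submod p).

Lemma tle_submod r : submod_closed (tle_pred r).
Proof.
split=> [|c t u /tleP ht /tleP hu]; apply/tleP => w hw; first exact: mcoeff0.
by rewrite mcoeffD mcoeffZ ht // hu // mulr0 addr0.
Qed.

HB.instance Definition _ r :=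
  GRing.isSubmodClosed.Build K tensV (tle_pred r) (tle_submod r).

Record tle (r : nat) := Tle { tle_val :> tensV; _ : tle_val \in tle_pred r }.
HB.instance Definition _ r := [isSub for @tle_val r].
HB.instance Definition _ r := [Choice of tle r by <:].
HB.instance Definition _ r := [SubChoice_isSubLmodule of tle r by <:].

Lemma mcoeff_natact X i j : (natact X << j >>)@_i = X@_(i, j).
Proof.
rewrite /natact lextU raddf_sum /=.
under eq_bigr => p _ do rewrite mcoeffZ mcoeffU.
case: (msuppP X (i, j)) => hij; last first.
  rewrite big1_seq // => -[a b] /andP[/= /eqP -> ab].
  rewrite (_ : (a == i) = false) ?mulr0n ?mulr0 //; apply/eqP => ai.
  by rewrite ai (negbTE hij) in ab.
rewrite big_mkcond (big_fsetD1 (i, j)) //= !eqxx mulr1n mulr1 big1_fset ?addr0 //.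
move=> -[a b] /=; rewrite !inE xpair_eqE => /andP[ne _] _.
have [bj|//] := eqVneq b j; move: ne; rewrite bj eqxx andbT => /negbTE ->.
by rewrite mulr0n mulr0.
Qed.

Lemma mcoeff_ulc n (A : 'M[K]_n) (i j : 'I_n) : (ulc A)@_(val i, val j) = A i j.
Proof.
rewrite /ulc raddf_sum (bigD1 i) //= raddf_sum (bigD1 j) //= mcoeffUU.
rewrite !big1 ?addr0 // => [k /negbTE ki|k /negbTE kj].
  rewrite raddf_sum big1 //= => l _.
  by rewrite mcoeffU xpair_eqE !val_eqE ki.
by rewrite mcoeffU xpair_eqE !val_eqE kj andbF.
Qed.

Lemma mcoeff_ulcE n (A : 'M[K]_n) i j (hi : (i < n)%N) (hj : (j < n)%N) :
  (ulc A)@_(i, j) = A (Ordinal hi) (Ordinal hj).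
Proof. exact: (mcoeff_ulc A (Ordinal hi) (Ordinal hj)). Qed.

Lemma mcoeff_ulc_out n (A : 'M[K]_n) i j :
  (n <= i)%N || (n <= j)%N -> (ulc A)@_(i, j) = 0.
Proof.
move=> out; rewrite /ulc raddf_sum big1 //= => k _; rewrite raddf_sum big1 //=.
move=> l _; rewrite mcoeffU xpair_eqE; case: eqP => //= ki; case: eqP => //= lj.
by rewrite -ki -lj leqNgt ltn_ord leqNgt ltn_ord in out.
Qed.

(* The upper left corner inclusions restrict to o(n) -> o(m) and              *)
(* sp(2n) -> sp(2m) for n <= m.                                               *)

Definition ulc_incl (n m : nat) (A : 'M[K]_n) : 'M[K]_m :=
  \matrix_(i, j) (ulc A)@_(val i, val j).

Lemma ulc_inclK n m (A : 'M[K]_n) : (n <= m)%N -> ulc (ulc_incl m A) = ulc A.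
Proof.
move=> nm; apply/malgP => -[i j].
case: (ltnP i m) => im; last first.
  by rewrite !mcoeff_ulc_out ?im //= (leq_trans nm im).
case: (ltnP j m) => jm; last first.
  by rewrite !mcoeff_ulc_out ?jm ?orbT //= (leq_trans nm jm) orbT.
by rewrite mcoeff_ulcE mxE.
Qed.

Lemma o_fin_incl n m (A : 'M[K]_n) : o_fin A -> o_fin (ulc_incl m A).
Proof.
move=> hA; apply/matrixP => i j; rewrite !mxE /=.
case: (ltnP i n) => hi; last by rewrite !mcoeff_ulc_out ?hi ?orbT ?oppr0.
case: (ltnP j n) => hj; last by rewrite !mcoeff_ulc_out ?hj ?orbT ?oppr0.
rewrite !mcoeff_ulcE.
by have /matrixP/(_ (Ordinal hi) (Ordinal hj)) := hA; rewrite !mxE.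
Qed.

Lemma tensUU u w : tens << u >> << w >> = << u ++ w >>.
Proof. by rewrite /tens !lextU. Qed.

Lemma tens_is_linearl t : linear (tens^~ t).
Proof. by move=> c s u; rewrite /tens linearP. Qed.

Lemma tens_is_linearr s : linear (tens s).
Proof.
move=> c t u; rewrite /tens !lextE scaler_sumr -big_split /=.
by apply: eq_bigr => w _; rewrite linearP scalerDr !scalerA mulrC.
Qed.

HB.instance Definition _ s :=
  GRing.isLinear.Build K tensV tensV *:%R (tens s) (tens_is_linearr s).

Lemma tensPl c s t u : tens (c *: s + t) u = c *: tens s u + tens t u.
Proof. exact: tens_is_linearl. Qed.

Lemma tensPr c s t u : tens s (c *: t + u) = c *: tens s t + tens s u.
Proof. exact: tens_is_linearr. Qed.

Lemma tens0l t : tens 0 t = 0.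
Proof. by rewrite /tens linear0. Qed.

Lemma tens0r s : tens s 0 = 0.
Proof. exact: linear0. Qed.

Lemma tens_suml I (r : seq I) (P : pred I) (F : I -> tensV) t :
  tens (\sum_(i <- r | P i) F i) t = \sum_(i <- r | P i) tens (F i) t.
Proof. by rewrite /tens linear_sum. Qed.

Lemma tens_sumr I (r : seq I) (P : pred I) (F : I -> tensV) s :
  tens s (\sum_(i <- r | P i) F i) = \sum_(i <- r | P i) tens s (F i).
Proof. exact: linear_sum. Qed.

Lemma tensA : associative tens.
Proof.
move=> s t u; elim/malg_ind: s => [|a|c s1 s2 e1 e2].
- by rewrite !tens0l.
- elim/malg_ind: t => [|b|c t1 t2 e1 e2].
  + by rewrite !(tens0l, tens0r).
  + elim/malg_ind: u => [|d|c u1 u2 e1 e2].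
    * by rewrite !tens0r.
    * by rewrite !tensUU catA.
    * rewrite [in LHS]tensPr [in LHS]tensPr [RHS]tensPr.
      apply: (congr2 +%R); last exact: e2.
      by apply: (congr1 ( *:%R c)); exact: e1.
  + by rewrite tensPl !tensPr tensPl e1 e2.
- by rewrite !tensPl e1 e2.
Qed.

Lemma tens1l : left_id << [::] >> tens.
Proof.
by elim/malg_ind=> [|w|c s t es et]; rewrite ?tens0r ?tensUU // tensPr es et.
Qed.

Lemma tens1r : right_id << [::] >> tens.
Proof.
elim/malg_ind=> [|w|c s t es et]; rewrite ?tens0l ?tensUU ?cats0 //.
by rewrite tensPl es et.
Qed.

Lemma inVU i : inV << i >> = << [:: i] >>.
Proof. exact: lextU. Qed.

Lemma act_basis X w : act X << w >> = act_word X w.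
Proof. exact: lextU. Qed.

Lemma act_inV X v : act X (inV v) = inV (natact X v).
Proof.
apply: (malg_linP (f := act X \o inV) (h := inV \o natact X)) => i /=.
by rewrite inVU act_basis /act_word big_ord_recl big_ord0 /= addr0 tens1l tens1r.
Qed.

Lemma act_one X : act X << [::] >> = 0.
Proof. by rewrite act_basis /act_word big_ord0. Qed.

Lemma act_tensUU X s t :
  act X << s ++ t >> =
  tens (act X << s >>) << t >> + tens << s >> (act X << t >>).
Proof.
rewrite !act_basis /act_word size_cat big_split_ord /= tens_suml tens_sumr.
apply: (congr2 +%R); apply: eq_bigr => k _.
- have ks := ltn_ord k; have tk := takel_cat t (ltnW ks).
  have -> : drop k.+1 (s ++ t) = drop k.+1 s ++ t.
    rewrite drop_cat; case: ltnP => // hk; rewrite [drop _ s]drop_oversize //.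
    have /eqP -> : (k.+1 - size s == 0)%N by rewrite subn_eq0.
    by rewrite drop0.
  by rewrite nth_cat ks tk -[RHS]tensA tensUU.
- have nk : (size s + k < size s)%N = false by rewrite ltnNge leq_addr.
  have nk1 : (size s + k.+1 < size s)%N = false by rewrite ltnNge leq_addr.
  rewrite nth_cat take_cat nk -addnS drop_cat nk1 !addKn -tensUU.
  by rewrite [RHS]tensA [in RHS]tensA.
Qed.

Lemma actP X c s t : act X (c *: s + t) = c *: act X s + act X t.
Proof. exact: linearP. Qed.

Lemma act_tens X s t :
  act X (tens s t) = tens (act X s) t + tens s (act X t).
Proof.
elim/malg_ind: s => [|u|c s1 s2 e1 e2].
- by rewrite !(tens0l, linear0) addr0.
- elim/malg_ind: t => [|v|c t1 t2 e1 e2].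
  + by rewrite !(tens0r, linear0) addr0.
  + by rewrite tensUU act_tensUU.
  + rewrite tensPr 2!actP 2!tensPr e1 e2 scalerDr.
    exact: addrACA.
- by rewrite tensPl !actP !tensPl e1 e2 scalerDr addrACA.
Qed.

Lemma homog_tens p q (s t : tensV) :
  s \in homog p -> t \in homog q -> tens s t \in homog (p + q).
Proof.
move=> /allP hs /allP ht; rewrite (malg_basisE s) tens_suml big_seq.
apply: rpred_sum => u us; rewrite -[_ *: _]addr0 tensPl tens0l addr0 rpredZ //.
rewrite (malg_basisE t) tens_sumr big_seq; apply: rpred_sum => v vt.
rewrite -[_ *: _]addr0 tensPr tens0r addr0 rpredZ // tensUU; apply/homogP => w.
rewrite mcoeffU; have [<-|//] := eqVneq _ w.
by rewrite size_cat (eqP (hs _ us)) (eqP (ht _ vt)) eqxx.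
Qed.

Lemma homogU w : << w >> \in homog (size w).
Proof.
apply/homogP => u; rewrite mcoeffU; have [<-|//] := eqVneq w u.
by rewrite eqxx.
Qed.

Lemma inV_homog v : inV v \in homog 1.
Proof.
rewrite /inV lextE; apply: rpred_sum => i _; apply: rpredZ.
exact: (homogU [:: i]).
Qed.

Lemma act_word_homog X w : act_word X w \in homog (size w).
Proof.
rewrite /act_word; apply: rpred_sum => k _.
have := homog_tens (homog_tens (homogU (take k w))
  (inV_homog (natact X << nth 0%N w k >>))) (homogU (drop k.+1 w)).
by rewrite size_takel ?size_drop 1?ltnW // addn1 subnKC.
Qed.

Lemma sp_fin_incl n m (A : 'M[K]_(n.*2)) :
  (n <= m)%N -> sp_fin A -> sp_fin (ulc_incl m.*2 A).
Proof.
move=> nm hA; set N := n.*2 in A hA *.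
have nm2 : (N <= m.*2)%N by rewrite leq_double.
pose J (i j : nat) : K := if ~~ odd i && (j == i.+1) then 1
                  else if odd i && (i == j.+1) then -1 else 0.
pose a i j := (ulc A)@_(i, j).
have a0 i j : (N <= i)%N || (N <= j)%N -> a i j = 0 by exact: mcoeff_ulc_out.
have evN i : ~~ odd i -> (i < N)%N -> (i.+1 < N)%N.
  move=> ev; rewrite leq_eqVlt => /orP[/eqP e|//].
  by move: ev; rewrite -[odd i]negbK -oddS e odd_double.
have J0 i j : (i < N)%N -> (N <= j)%N -> J i j = 0 /\ J j i = 0.
  move=> hi hj; have ji : (j.+1 == i) = false.
    by apply: contraTF hi => /eqP <-; rewrite -leqNgt leqW.
  have ij b : ~~ b = ~~ odd i -> ~~ b && (j == i.+1) = false.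
    move=> ->; apply/negP => /andP[/evN/(_ hi) + /eqP e].
    by rewrite -e ltnNge hj.
  split; rewrite /J ?[i == _]eq_sym ji ?andbF.
    by rewrite ij.
  case: ifP => // /andP[od /eqP e].
  have /negP[] := ij (odd i) erefl; rewrite e eqxx andbT.
  by rewrite e /= in od.
pose F i j k := a k i * J k j + J i k * a k j.
have sumF (i j : nat) (M : nat) (B : 'M[K]_M) (ii jj : 'I_M) :
    (forall k l : 'I_M, B k l = a k l) -> i = val ii -> j = val jj ->
    (B^T *m symp_mx M + symp_mx M *m B) ii jj = \sum_(k < M) F i j k.
  move=> hB -> ->; rewrite !mxE -big_split; apply: eq_bigr => k _ /=.
  by rewrite !mxE !hB.
apply/matrixP => i j; rewrite (sumF i j) //; last first.
  by move=> k l; rewrite mxE.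
rewrite mxE.
have -> : \sum_(k < m.*2) F i j k = \sum_(k < N) F i j k.
  rewrite (big_ord_widen _ (F i j) nm2) [RHS]big_mkcond /=.
  apply: eq_bigr => k _; case: ltnP => // hk.
  by rewrite /F !a0 ?hk // mulr0 mul0r addr0.
case: (ltnP i N) => hi; last first.
  apply: big1 => k _; have [_ e] := J0 k i (ltn_ord k) hi.
  by rewrite /F a0 ?hi ?orbT // e !mul0r addr0.
case: (ltnP j N) => hj; last first.
  apply: big1 => k _; have [e _] := J0 k j (ltn_ord k) hj.
  by rewrite /F (a0 k j) ?hj ?orbT // e !mulr0 addr0.
rewrite -(sumF _ _ _ A (Ordinal hi) (Ordinal hj)) //; last first.
  by move=> k l; rewrite -(mcoeff_ulc A).
by rewrite hA mxE.
Qed.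

Lemma act_tle X r t : t \in tle_pred r -> act X t \in tle_pred r.
Proof.
move=> /tleP ht; apply/tleP => u hu; rewrite /act mcoeff_lext big1 // => w _.
have [rw|wr] := ltnP r (size w); first by rewrite ht // mul0r.
have /homogP -> := act_word_homog X w; first by rewrite mulr0.
by apply: contraTneq hu => ->; rewrite -leqNgt.
Qed.

Lemma homog_tle p r t : (p <= r)%N -> t \in homog p -> t \in tle_pred r.
Proof.
move=> pr /homogP ht; apply/tleP => w rw; apply: ht.
by apply: contraTneq rw => ->; rewrite -leqNgt.
Qed.

Lemma tle_decomp r t : t \in tle_pred r ->
  exists u : nat -> tensV,
    (forall p, u p \in homog p) /\ t = \sum_(p < r.+1) u p.
Proof.
move=> /allP ht; pose b (p : nat) (w : seq nat) : tensV :=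
  if size w == p then << w >> else 0.
exists (fun p => lext (b p) t); split=> [p|].
  apply/homogP => w wp; rewrite mcoeff_lext big1 // => v _; rewrite /b.
  case: eqP => [vp|_]; last by rewrite mcoeff0 mulr0.
  rewrite mcoeffU; have [vw|_] := eqVneq v w; last by rewrite mulr0.
  by rewrite -vw vp eqxx in wp.
under eq_bigr do rewrite lextE.
rewrite exchange_big [LHS]malg_basisE big_seq [RHS]big_seq.
apply: eq_bigr => w wt; have hw := ht _ wt.
rewrite -scaler_sumr (bigD1 (Ordinal (hw : (size w < r.+1)%N))) //= /b eqxx.
rewrite big1 ?addr0 // => p; rewrite -val_eqE /= eq_sym => /negbTE -> //.
Qed.

Definition act_le (X : glinf) (r : nat) (t : tle r) : tle r :=
  Tle (act_tle X (valP t)).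

Definition trunc (r : nat) : tensV -> tensV :=
  lext (fun w => if (size w <= r)%N then << w >> else 0).

HB.instance Definition _ r := GRing.Linear.copy (trunc r) (lext _).

Lemma mcoeff_trunc r t w :
  (trunc r t)@_w = if (size w <= r)%N then t@_w else 0.
Proof.
rewrite /trunc mcoeff_lext.
under eq_bigr => u _ do rewrite (fun_if (mcoeff w)) mcoeffU mcoeff0.
case: (msuppP t w) => wt; last first.
  rewrite big1_seq ?if_same // => u /andP[_ ut].
  by case: eqP => [e|_]; rewrite ?if_same ?mulr0 //; rewrite -e ut in wt.
rewrite (big_fsetD1 w) //= eqxx big1_fset ?addr0 //.
  by case: ifP => _; rewrite ?mulr1 ?mulr0.
move=> u; rewrite !inE => /andP[/negbTE -> _] _.
by rewrite if_same mulr0.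
Qed.

Lemma trunc_subproof r t : trunc r t \in tle_pred r.
Proof. by apply/tleP => w; rewrite mcoeff_trunc ltnNge => /negbTE ->. Qed.

Definition to_tle (r : nat) (t : tensV) : tle r := Tle (trunc_subproof r t).

Lemma to_tle_is_linear r : linear (to_tle r).
Proof. by move=> c s t; apply: val_inj; rewrite /= linearP. Qed.

HB.instance Definition _ r :=
  GRing.isLinear.Build K tensV (tle r) *:%R (to_tle r) (to_tle_is_linear r).

Lemma to_tle_id r s (t : tle r) : (r <= s)%N -> val (to_tle s (val t)) = val t.
Proof.
move=> rs; apply/malgP => w; rewrite mcoeff_trunc; case: leqP => // sw.
by have /tleP -> := valP t; last exact: leq_ltn_trans sw.
Qed.

Lemma to_tleK r s (t : tle r) :
  (r <= s)%N -> to_tle r (val (to_tle s (val t))) = t.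
Proof. by move=> rs; apply: val_inj; rewrite (to_tle_id t rs) to_tle_id. Qed.

Lemma act_trunc X r t : act X (trunc r t) = trunc r (act X t).
Proof.
apply: (malg_linP (f := act X \o trunc r) (h := trunc r \o act X)) => w /=.
rewrite {1}/trunc lextU; case: ifP => wr.
  have wt : (<< w >> : tensV) \in tle_pred r.
    apply/tleP => v; rewrite mcoeffU; have [<-|//] := eqVneq w v.
    by rewrite ltnNge wr.
  have /tleP aw := act_tle X wt.
  apply/malgP => u; rewrite mcoeff_trunc; case: leqP => // ru.
  exact: aw.
rewrite linear0 act_basis; apply/malgP => u; rewrite mcoeff0 mcoeff_trunc.
case: ifP => // ur; have /homogP -> // := act_word_homog X w.
by apply: contraFneq wr => <-.
Qed.

Lemma to_tle_act X r t : to_tle r (act X t) = act_le X (to_tle r t).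
Proof. by apply: val_inj; rewrite /= act_trunc. Qed.

(* End_g(T^{<= r}), for g a set of elements of gl(oo)                         *)

Section Endomorphisms.
Variable g : glinf -> Prop.

Definition is_endg (r : nat) (phi : tle r -> tle r) : Prop :=
  linear phi /\
  forall X, g X -> forall t, phi (act_le X t) = act_le X (phi t).

Definition endg_pred (r : nat) : {pred (tle r -> tle r)} :=
  fun phi => `[< is_endg phi >].
Arguments endg_pred : clear implicits.

Lemma act_le_linear X r : linear (@act_le X r).
Proof. by move=> c s t; apply: val_inj; rewrite /= linearP. Qed.

Lemma endg_submod r : submod_closed (endg_pred r).
Proof.
split=> [|c phi psi /asboolP[lp ep] /asboolP[lq eq]]; apply/asboolP; split.
- by move=> c s t; rewrite /= scaler0 addr0.
- by move=> X _ t; apply: val_inj; rewrite /= linear0.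
- move=> d s t; rewrite !fctE lp lq !scalerDr !scalerA (mulrC c).
  by rewrite addrACA.
- by move=> X gX t; rewrite !fctE ep // eq // act_le_linear.
Qed.

HB.instance Definition _ r :=
  GRing.isSubmodClosed.Build K (tle r -> tle r) (endg_pred r) (endg_submod r).

Record endg (r : nat) :=
  EndG { endg_val :> tle r -> tle r; _ : endg_val \in endg_pred r }.
HB.instance Definition _ r := [isSub for @endg_val r].
HB.instance Definition _ r := [Choice of endg r by <:].
HB.instance Definition _ r := [SubChoice_isSubLmodule of endg r by <:].

Lemma endg_linear r (phi : endg r) : linear phi.
Proof. by case: phi => phi /= /asboolP[]. Qed.

Lemma endg_equiv r (phi : endg r) X :
  g X -> forall t, phi (act_le X t) = act_le X (phi t).
Proof. by case: phi => phi /= /asboolP[_ h] /h. Qed.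

HB.instance Definition _ r (phi : endg r) :=
  GRing.isLinear.Build K (tle r) (tle r) *:%R phi (endg_linear phi).

Lemma endg_ext r (phi psi : endg r) : (forall t, phi t = psi t) -> phi = psi.
Proof. by move=> e; apply: val_inj; apply/funext. Qed.

Lemma endg_mul_subproof r (phi psi : endg r) :
  (fun t => phi (psi t)) \in endg_pred r.
Proof.
apply/asboolP; split=> [c s t|X gX t]; first by rewrite !linearP.
by rewrite !endg_equiv.
Qed.

Definition endg_mul r (phi psi : endg r) : endg r :=
  EndG (endg_mul_subproof phi psi).

Lemma endg_mulA r : associative (@endg_mul r).
Proof. by move=> *; apply: endg_ext. Qed.
Lemma endg_mulDl r : left_distributive (@endg_mul r) +%R.
Proof. by move=> *; apply: endg_ext. Qed.
Lemma endg_mulDr r : right_distributive (@endg_mul r) +%R.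
Proof. by move=> phi psi chi; apply: endg_ext => t; rewrite /= linearD. Qed.
Lemma endg_scaleAl r (c : K) (phi psi : endg r) :
  c *: endg_mul phi psi = endg_mul (c *: phi) psi.
Proof. exact: endg_ext. Qed.
Lemma endg_scaleAr r (c : K) (phi psi : endg r) :
  c *: endg_mul phi psi = endg_mul phi (c *: psi).
Proof. by apply: endg_ext => t; rewrite /= linearZ. Qed.

Definition endg_alg (r : nat) : assocAlg K :=
  AssocAlg (@endg_mulA r) (@endg_mulDl r) (@endg_mulDr r)
    (@endg_scaleAl r) (@endg_scaleAr r).

(* Extension by zero: T^{<= s} -> T^{<= r} -> T^{<= r} -> T^{<= s}, where the *)
(* first map kills T^p for p > r and the last one is the inclusion (r <= s).  *)

Lemma endg_incl_subproof r s (phi : endg r) :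
  (fun t : tle s => to_tle s (val (phi (to_tle r (val t)))))
    \in endg_pred s.
Proof.
apply/asboolP; split=> [c t u|X gX t]; first by rewrite !linearP.
have -> : to_tle r (val (act_le X t)) = act_le X (to_tle r (val t)).
  exact: to_tle_act.
by rewrite endg_equiv // -to_tle_act.
Qed.

Definition endg_incl r s (phi : endg_alg r) : endg_alg s :=
  EndG (endg_incl_subproof s phi).

Lemma endg_inclE r s (phi : endg_alg r) (t : tle s) :
  endg_incl s phi t = to_tle s (val (phi (to_tle r (val t)))).
Proof. by []. Qed.

Lemma endg_incl_hom r s : (r <= s)%N -> alg_hom (@endg_incl r s).
Proof.
move=> rs; split=> [c phi psi|phi psi]; apply: endg_ext => t.
  by rewrite endg_inclE /= linearP.
rewrite endg_inclE -[RHS]/(endg_incl s phi (endg_incl s psi t)).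
by rewrite !endg_inclE to_tleK.
Qed.

Lemma endg_incl_id r (phi : endg_alg r) : endg_incl r phi = phi.
Proof.
apply: endg_ext => t; rewrite endg_inclE.
have e (u : tle r) : to_tle r (val u) = u by apply: val_inj; rewrite to_tle_id.
by rewrite !e.
Qed.

Lemma endg_incl_comp r s k : (r <= s)%N -> (s <= k)%N ->
  forall phi : endg_alg r, endg_incl k (endg_incl s phi) = endg_incl k phi.
Proof.
move=> rs sk phi; apply: endg_ext => t; rewrite !endg_inclE.
have -> : to_tle r (val (to_tle s (val t))) = to_tle r (val t).
  apply: val_inj; apply/malgP => w; rewrite /= !mcoeff_trunc.
  by case: ifP => // wr; rewrite (leq_trans wr rs).
by apply: val_inj; rewrite /= [trunc s _](to_tle_id _ rs).
Qed.

Definition endg_sys : dirSys K :=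
  @DirSys K endg_alg endg_incl endg_incl_hom endg_incl_id endg_incl_comp.

(* A_g, the direct limit of the algebras End_g(T^{<= r})                      *)
Definition A_alg : assocAlg K := dirlim_alg endg_sys.

End Endomorphisms.

End TensorModules.

(* Main.v *)
(** Super-mathematics supplies the bridge: [o(oo)] and [sp(oo)] both sit in
    [osp(oo|oo)], acting on the even and on the odd part of the natural
    representation.  Let [L] be the disjoint union of the two alphabets indexing
    these bases.  An operator on the words in [L] commuting with all
    infinitesimal orthosymplectic operators restricts to the words in either
    alphabet, compatibly with products, so it is enough to see that both
    restriction maps are bijective.

    Restriction is injective because a letter outside a given infinite alphabet
    can be exchanged for a fresh letter of it.  For surjectivity, an invariant
    operator is encoded as an invariant functional; replacing the first letter of
    a word by a fresh one expresses the functional through super-contractions of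
    that letter with the others, composed with invariant functionals on words
    shorter by two letters, which extend to [L] by induction. *)

From HB Require Import structures.
Require Import Defs.
From mathcomp Require Import all_boot all_algebra reals complex.
From mathcomp Require Import boolp finmap monalg ring zify.

Set Implicit Arguments.
Unset Strict Implicit.
Unset Printing Implicit Defensive.

Import GRing.Theory.

Local Open Scope ring_scope.

(** * Supersymmetric forms and infinitesimal operators on words *)

(** A homogeneous basis in which each letter [a] pairs only with [bar a], with value [eps a]. The
    last axiom is supersymmetry: the form is symmetric on even letters and alternating on odd
    ones. *)
Record superform (K : fieldType) (L : choiceType) := Superform {
  par : L -> bool;
  bar : L -> L;
  eps : L -> K;
  barK : involutive bar;
  par_bar : forall a, par (bar a) = par a;
  eps_neq0 : forall a, eps a != 0;
  eps_bar : forall a, eps (bar a) = if par a then - eps a else eps a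
}.

Section Words.
Variables (K : fieldType) (L : choiceType) (Q : superform K L).
Notation par := (par Q).
Notation bar := (bar Q).
Notation eps := (eps Q).
Implicit Types (a b i j k l : L) (w z u v : seq L) (F G : seq L -> K).

Definition sgn (s : bool) : K := if s then -1 else 1.

Definition bform a b : K := if b == bar a then eps a else 0.

(* The operator [x_ij] of the orthosymplectic Lie superalgebra maps [j] to [i] *)
(* and [bar i] to [xcoef i j] times [bar j]; its parity is [xpar i j]. *)
Definition xpar i j : bool := par i (+) par j.

Definition xcoef i j : K := - (sgn (xpar i j && par j) * eps i / eps j).

Lemma bar_inj : injective bar. Proof. exact: can_inj (@barK _ _ Q). Qed.

Lemma bar_eq a b : (bar a == b) = (a == bar b).
Proof. by rewrite -(inj_eq bar_inj) barK. Qed.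

(* [dl i j F w] is [F (x_ij w)], with [F] extended linearly. *)
Fixpoint dl i j F w : K :=
  if w is a :: w' then
    (if a == j then F (i :: w') else 0) +
    (if a == bar i then xcoef i j * F (bar j :: w') else 0) +
    sgn (xpar i j && par a) * dl i j (fun v => F (a :: v)) w'
  else 0.

(* [dr i j G u] is the coefficient at [u] of [x_ij] applied to the vector with *)
(* coefficients [G]. *)
Fixpoint dr i j G u : K :=
  if u is b :: u' then
    (if b == i then G (j :: u') else 0) +
    (if b == bar j then xcoef i j * G (bar i :: u') else 0) +
    sgn (xpar i j && par b) * dr i j (fun v => G (b :: v)) u'
  else 0.

(** Besides letters of [w], only [i] and [bar j] can occur in [x_ij w]. Recording this lets [F] and
    [G] differ on words with other letters, which freshness arguments require. *)
Lemma dl_ext i j F G w :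
  (forall v, size v = size w -> {subset v <= [:: i, bar j & w]} -> F v = G v) ->
  dl i j F w = dl i j G w.
Proof.
elim: w F G => [|a w IHw] F G e //=.
have sub b : b \in [:: i; bar j; a] ->
    {subset b :: w <= [:: i, bar j, a & w]}.
  move=> hb c; rewrite inE => /predU1P[->|cw]; last by rewrite !inE cw !orbT.
  by move: hb; rewrite !inE => /or3P[]->; rewrite ?orbT.
rewrite !e ?(IHw _ (fun v => G (a :: v))) //; try by
  [apply: sub; rewrite !inE eqxx ?orbT].
move=> v sv hv; apply: e => [/=|c]; first by rewrite sv.
rewrite inE => /predU1P[->|/hv]; first by rewrite !inE eqxx !orbT.
by rewrite !inE => /or3P[]->; rewrite ?orbT.
Qed.

Lemma dr_ext i j F G w :
  (forall v, size v = size w -> F v = G v) -> dr i j F w = dr i j G w.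
Proof.
elim: w F G => [|a w IHw] F G e //=.
by rewrite !e // (IHw _ (fun v => G (a :: v))) // => v sv; rewrite e //= sv.
Qed.

Lemma dl_lin i j c F G w :
  dl i j (fun v => c * F v + G v) w = c * dl i j F w + dl i j G w.
Proof.
elim: w F G => [|a w IHw] F G /=; first by rewrite mulr0 addr0.
by rewrite IHw; case: ifP => _; case: ifP => _; ring.
Qed.

Lemma dl_0 i j w : dl i j (fun=> 0) w = 0.
Proof.
elim: w => [|a w IHw] //=.
by rewrite IHw; case: ifP => _; case: ifP => _; ring.
Qed.

Lemma dl_scale i j c F w : dl i j (fun v => c * F v) w = c * dl i j F w.
Proof.
have := dl_lin i j c F (fun=> 0) w; rewrite dl_0 addr0 => <-.
by apply: dl_ext => v _ _; rewrite addr0.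
Qed.

Lemma dl_sum i j n (P : pred 'I_n) (F : 'I_n -> seq L -> K) w :
  dl i j (fun v => \sum_(k < n | P k) F k v) w =
  \sum_(k < n | P k) dl i j (F k) w.
Proof.
elim: (index_enum _) => [|k s IHs].
  by rewrite big_nil -[RHS](dl_0 i j w); apply: dl_ext => v; rewrite big_nil.
rewrite big_cons -IHs; case: ifP => Pk.
  rewrite -[dl i j (F k) w]mul1r -dl_lin.
  by apply: dl_ext => v _ _; rewrite big_cons Pk mul1r.
by apply: dl_ext => v _ _; rewrite big_cons Pk.
Qed.

Definition wpar w : bool := foldr (fun a s => par a (+) s) false w.

Lemma wpar_cat v w : wpar (v ++ w) = wpar v (+) wpar w.
Proof. by elim: v => //= a v ->; rewrite addbA. Qed.

Lemma sgnM s t : sgn s * sgn t = sgn (s (+) t).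
Proof. by case: s; case: t; rewrite /sgn /= ?mulrNN ?mulr1 ?mul1r. Qed.

Lemma sgn_addb x s t : sgn (x && (s (+) t)) = sgn (x && s) * sgn (x && t).
Proof. by rewrite sgnM; case: x. Qed.

Lemma dl_cat i j F v w :
  dl i j F (v ++ w) = dl i j (fun v' => F (v' ++ w)) v +
    sgn (xpar i j && wpar v) * dl i j (fun w' => F (v ++ w')) w.
Proof.
elim: v F => [|a v IHv] F /=; first by rewrite andbF /= mul1r add0r.
by rewrite IHv sgn_addb; ring.
Qed.

Lemma dr_cat i j F v w :
  dr i j F (v ++ w) = dr i j (fun v' => F (v' ++ w)) v +
    sgn (xpar i j && wpar v) * dr i j (fun w' => F (v ++ w')) w.
Proof.
elim: v F => [|a v IHv] F /=; first by rewrite andbF /= mul1r add0r.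
by rewrite IHv sgn_addb; ring.
Qed.

Lemma xcoef_inv1 i j : sgn (xpar i j && par j) * xcoef i j * eps j = - eps i.
Proof.
by rewrite /xcoef; have := eps_neq0 Q j; case: (_ && _) => e /=; field.
Qed.

Lemma xcoef_inv2 i j :
  xcoef i j * eps (bar j) = - (sgn (xpar i j && par i) * eps (bar i)).
Proof.
rewrite /xcoef /xpar !eps_bar; have := eps_neq0 Q j.
by case: (par i); case: (par j) => e /=; field.
Qed.

(** The form is invariant under [x_ij]. The terms cancel in pairs: those with [a = j], [b = bar i]
    by [xcoef_inv1], those with [a = bar i], [b = j] by [xcoef_inv2]. *)
Lemma bform_inv i j a b :
  (if a == j then bform i b else 0) +
  (if a == bar i then xcoef i j * bform (bar j) b else 0) +
  sgn (xpar i j && par a) *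
    ((if b == j then bform a i else 0) +
     (if b == bar i then xcoef i j * bform a (bar j) else 0)) = 0.
Proof.
rewrite /bform barK (bar_eq j) barK (eq_sym i) bar_eq (eq_sym j a).
rewrite mulrDr [X in _ + _ + X]addrC addrACA.
have inv1 := xcoef_inv1 i j; have inv2 := xcoef_inv2 i j.
rewrite [X in X + _](_ : _ = 0) ?add0r.
  case: (a =P bar i) => [->|_]; last by case: ifP; rewrite mulr0 addr0.
  by case: (b == j); rewrite ?par_bar ?inv2; ring.
case: (a =P j) => [->|_]; last by case: ifP; rewrite ?mulr0 addr0.
by case: (b == bar i); rewrite ?mulrA ?inv1 ?mulr0 ?subrr ?addr0.
Qed.

End Words.

(** * Contractions *)

Section Contractions.
Variables (K : fieldType) (L : choiceType) (Q : superform K L).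
Notation par := (par Q).
Notation bar := (bar Q).
Notation eps := (eps Q).
Notation sgn := (@sgn K).
Notation sgnM := (@sgnM K).
Implicit Types (a b i j l : L) (w z u v : seq L) (F G : seq L -> K) (k m : nat).

(* [contr k a G w] is [G] after contracting the first letter of [a :: w] with *)
(* the letter of [w] at position [k]; [paste k j] inserts [bar j] there. *)
Fixpoint contr k a G w : K :=
  if w is b :: t then
    if k is k'.+1 then
      sgn (par a && par b) * contr k' a (fun v => G (b :: v)) t
    else bform Q a b * G t
  else 0.

Fixpoint paste k j F z : K :=
  if k is k'.+1 then
    if z is b :: t then
      sgn (par j && par b) * paste k' j (fun v => F (b :: v)) t
    else 0
  else F (bar j :: z).

(** The scalar stays implicit, since only its vanishing matters to [contr_bound]. *)
Lemma contrE k a G w : (k < size w)%N ->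
  exists c, contr k a G w = c * G (take k w ++ drop k.+1 w) /\
    (nth a w k != bar a -> c = 0).
Proof.
elim: k w G => [|k IHk] [|b t] G //= hk.
  by exists (bform Q a b); rewrite drop0; split=> // /negbTE; rewrite /bform => ->.
have [c [-> hc]] := IHk t (fun v => G (b :: v)) hk.
by exists (sgn (par a && par b) * c); rewrite mulrA; split=> // /hc ->; rewrite mulr0.
Qed.

Lemma contr_over k a G w : (size w <= k)%N -> contr k a G w = 0.
Proof. by elim: k w G => [|k IHk] [|b t] G //= hk; rewrite IHk ?mulr0. Qed.

Lemma pasteE k j F z : (k <= size z)%N ->
  paste k j F z =
  sgn (par j && wpar Q (take k z)) * F (take k z ++ bar j :: drop k z).
Proof.
elim: k z F => [|k IHk] [|b t] F //= hk; rewrite ?andbF /= ?mul1r //.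
by rewrite IHk // mulrA sgn_addb.
Qed.

Lemma contr_ext k a F G w :
  (forall z, size z = (size w).-1 -> {subset z <= w} -> F z = G z) ->
  contr k a F w = contr k a G w.
Proof.
elim: k w F G => [|k IHk] [|b t] F G e //=.
  by rewrite e // => c; rewrite inE => ->; rewrite orbT.
case: t e => [|c t] e; first by case: (k).
congr (_ * _); apply: IHk => z sz hz; apply: e => [|d]; first by rewrite /= sz.
by rewrite in_cons => /predU1P[->|/hz hd]; rewrite in_cons ?eqxx // hd orbT.
Qed.

Lemma contr_lin k a c F G w :
  contr k a (fun v => c * F v + G v) w = c * contr k a F w + contr k a G w.
Proof.
elim: k w F G => [|k IHk] [|b t] F G /=; rewrite ?mulr0 ?addr0 //; first by ring.
by rewrite IHk; ring.
Qed.

Lemma contr_0 k a w : contr k a (fun=> 0) w = 0.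
Proof. by elim: k w => [|k IHk] [|b t] //=; rewrite ?IHk mulr0. Qed.

Lemma contr_scale k a c F w : contr k a (fun v => c * F v) w = c * contr k a F w.
Proof.
have := contr_lin k a c F (fun=> 0) w; rewrite contr_0 addr0 => <-.
by apply: contr_ext => v _ _; rewrite addr0.
Qed.

Lemma contrD k a F G w :
  contr k a (fun v => F v + G v) w = contr k a F w + contr k a G w.
Proof.
by rewrite -[contr k a F w]mul1r -contr_lin; apply: contr_ext => v; rewrite mul1r.
Qed.

Lemma contr_if (s : bool) k a F w :
  contr k a (fun v => if s then F v else 0) w = if s then contr k a F w else 0.
Proof. by case: s => //; rewrite contr_0. Qed.

Lemma paste_ext k j F G z :
  (forall v, size v = (size z).+1 -> {subset v <= bar j :: z} -> F v = G v) ->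
  paste k j F z = paste k j G z.
Proof.
elim: k z F G => [|k IHk] z F G e /=; first by rewrite e.
case: z e => [|b t] e //; congr (_ * _); apply: IHk => v sv hv.
apply: e => [|d]; first by rewrite /= sv.
rewrite inE => /predU1P[->|/hv]; first by rewrite !inE eqxx orbT.
by rewrite !inE => /orP[]->; rewrite ?orbT.
Qed.

Lemma paste_lin k j c F G z :
  paste k j (fun v => c * F v + G v) z = c * paste k j F z + paste k j G z.
Proof.
elim: k z F G => [|k IHk] [|b t] F G //=; rewrite ?mulr0 ?addr0 //.
by rewrite IHk; ring.
Qed.

Lemma paste_0 k j z : paste k j (fun=> 0) z = 0.
Proof. by elim: k z => [|k IHk] [|b t] //=; rewrite IHk mulr0. Qed.

Lemma paste_scale k j c F z : paste k j (fun v => c * F v) z = c * paste k j F z.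
Proof.
have := paste_lin k j c F (fun=> 0) z; rewrite paste_0 addr0 => <-.
by apply: paste_ext => v _ _; rewrite addr0.
Qed.

Lemma pasteD k j F G z :
  paste k j (fun v => F v + G v) z = paste k j F z + paste k j G z.
Proof.
by rewrite -[paste k j F z]mul1r -paste_lin; apply: paste_ext => v; rewrite mul1r.
Qed.

Lemma paste_if (s : bool) k j F z :
  paste k j (fun v => if s then F v else 0) z = if s then paste k j F z else 0.
Proof. by case: s => //; rewrite paste_0. Qed.

Lemma paste_sum k j n (P : pred 'I_n) (F : 'I_n -> seq L -> K) z :
  paste k j (fun v => \sum_(m < n | P m) F m v) z =
  \sum_(m < n | P m) paste k j (F m) z.
Proof.
elim: (index_enum _) => [|m s IHs].
  by rewrite big_nil -[RHS](paste_0 k j z); apply: paste_ext => v; rewrite big_nil.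
rewrite big_cons -IHs; case: ifP => Pm.
  rewrite -[paste k j (F m) z]mul1r -paste_lin.
  by apply: paste_ext => v _ _; rewrite big_cons Pm mul1r.
by apply: paste_ext => v _ _; rewrite big_cons Pm.
Qed.

(** The left side is [x_ij] acting by the Leibniz rule on [a :: w] before the contraction. By
    invariance of the form, the terms that touch the two contracted letters cancel. *)
Lemma contr_dl k i j a G w :
  (if a == j then contr k i G w else 0) +
  (if a == bar i then xcoef Q i j * contr k (bar j) G w else 0) +
  sgn (xpar Q i j && par a) * dl Q i j (contr k a G) w =
  contr k a (dl Q i j G) w.
Proof.
elim: k w a G => [|k IHk] [|b t] a G /=; rewrite ?mulr0 ?if_same ?addr0 //.
  have := bform_inv Q i j a b; set x := xpar Q i j => e.
  rewrite dl_scale.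
  (* A nonzero contraction forces [a] and [b] to have equal parity, so the two signs cancel. *)
  have es : sgn (x && par a) * (sgn (x && par b) * (bform Q a b * dl Q i j G t)) =
      bform Q a b * dl Q i j G t.
    rewrite /bform; case: eqP => [->|_]; last by rewrite !mul0r !mulr0.
    by rewrite par_bar [LHS]mulrA sgnM addbb mul1r.
  rewrite mulrDr es addrA -[RHS]add0r; congr (_ + _).
  rewrite -[RHS](mul0r (G t)) -[in RHS]e.
  by case: (a == j); case: (a == bar i); case: (b == j); case: (b == bar i); ring.
rewrite dl_scale -/(dl Q i j _ _).
rewrite !contrD contr_scale -(IHk _ a) !contr_if contr_scale par_bar.
set x := xpar Q i j.
(* [E1] to [E4] compare the sign for exchanging [a] and [b] before and after [x_ij] changes the
   parity of one of them by [xpar i j]. *)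
have E1 X : (if a == j then sgn (par i && par b) * X else 0) =
    sgn (par a && par b) * (sgn (x && par b) * if a == j then X else 0).
  case: eqP => [->|_]; last by rewrite !mulr0.
  by rewrite /x /xpar mulrA sgnM; case: (par i); case: (par j); case: (par b).
have E2 X : (if a == bar i then xcoef Q i j * (sgn (par j && par b) * X) else 0) =
    sgn (par a && par b) * (sgn (x && par b) *
      if a == bar i then xcoef Q i j * X else 0).
  case: eqP => [->|_]; last by rewrite !mulr0.
  rewrite par_bar mulrCA !mulrA sgnM /x /xpar.
  by case: (par i); case: (par j); case: (par b).
have E3 X : sgn (x && par a) * (if b == j then sgn (par a && par i) * X else 0) =
    sgn (par a && par b) * if b == j then X else 0.
  case: eqP => [->|_]; last by rewrite !mulr0.
  by rewrite mulrA sgnM /x /xpar; case: (par i); case: (par j); case: (par a).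
have E4 X : sgn (x && par a) *
      (if b == bar i then xcoef Q i j * (sgn (par a && par j) * X) else 0) =
    sgn (par a && par b) * if b == bar i then xcoef Q i j * X else 0.
  case: eqP => [->|_]; last by rewrite !mulr0.
  rewrite par_bar [xcoef _ _ _ * (sgn _ * _)]mulrCA [LHS]mulrA sgnM /x /xpar.
  by case: (par i); case: (par j); case: (par a).
rewrite 2!mulrDr E1 E2 E3 E4.
move: (dl _ _ _ _ _) (if a == j then _ else _) (if a == bar i then _ else _)
  (if b == j then _ else _) (if b == bar i then _ else _) => X1 X2 X3 X4 X5.
by ring.
Qed.

(** [x_ij] kills [bar j0], hence acts on the remaining letters only; the sign comes from exchanging
    it with a letter of parity [par j0]. *)
Lemma paste_dl k j0 i j F z :
  j0 != i -> j0 != j -> bar j0 != j -> j0 != bar j ->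
  dl Q i j (paste k j0 F) z = sgn (xpar Q i j && par j0) * paste k j0 (dl Q i j F) z.
Proof.
move=> n1 n2 n3 n4; set x := xpar Q i j.
elim: k z F => [|k IHk] z F /=.
  rewrite (negbTE n3) (inj_eq (@bar_inj _ _ Q)) (negbTE n1) par_bar !add0r.
  by rewrite mulrA sgnM addbb mul1r.
case: z => [|b t] /=; first by rewrite mulr0.
rewrite !pasteD !paste_if !paste_scale dl_scale IHk !par_bar -/x.
have E1 X : (if b == j then sgn (par j0 && par i) * X else 0) =
    sgn (x && par j0) * (sgn (par j0 && par b) * if b == j then X else 0).
  case: eqP => [->|_]; last by rewrite !mulr0.
  by rewrite /x /xpar mulrA sgnM; case: (par i); case: (par j); case: (par j0).
have E2 X : (if b == bar i then xcoef Q i j * (sgn (par j0 && par j) * X) else 0) =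
    sgn (x && par j0) * (sgn (par j0 && par b) *
      if b == bar i then xcoef Q i j * X else 0).
  case: eqP => [->|_]; last by rewrite !mulr0.
  rewrite par_bar mulrCA !mulrA sgnM /x /xpar.
  by case: (par i); case: (par j); case: (par j0).
rewrite E1 E2; move: (if b == j then _ else _) (if b == bar i then _ else _) => X1 X2; ring.
Qed.

Lemma contr_notin k a G w : bar a \notin w -> contr k a G w = 0.
Proof.
elim: k w G => [|k IHk] [|b t] G //=; rewrite inE negb_or => /andP[nb bt].
  by rewrite /bform eq_sym (negbTE nb) mul0r.
by rewrite IHk // mulr0.
Qed.

(** The pasted [bar l] is the only possible partner of [l]. This orthogonality isolates a single
    coefficient in an expansion by contractions. *)
Lemma contr_paste_fresh k m l G z :
  bar l \notin z -> (k <= size z)%N ->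
  paste k l (contr m l G) z = if k == m then eps l * G z else 0.
Proof.
elim: k m z G => [|k IHk] m z G blz kz /=.
  case: m => [|m] /=; first by rewrite /bform eqxx.
  by rewrite contr_notin ?mulr0.
case: z blz kz => [|b t] //; rewrite inE negb_or => /andP[nb bt] kt.
case: m => [|m] /=.
  under [X in _ * X]paste_ext => v _ _ do rewrite /bform eq_sym (negbTE nb) mul0r.
  by rewrite paste_0 mulr0.
rewrite paste_scale IHk // mulrA sgnM addbb mul1r.
by rewrite eqSS.
Qed.

(** As [j] is absent from [w], [x_aj] can only turn a letter [bar a] into [bar j]. This amounts to
    contracting [a] with that letter and pasting [bar j] at the same place. *)
Lemma dl_contr_sum a j h w :
  j \notin w -> 
  - (sgn (xpar Q a j && par j) * dl Q a j h w) =
  \sum_(k < size w) contr k a (fun z => (eps j)^-1 * paste k j h z) w.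
Proof.
elim: w h => [|b t IHt] h; first by rewrite big_ord0 /= mulr0 oppr0.
rewrite inE negb_or => /andP[njb jt] /=.
rewrite big_ord_recl /= eq_sym (negbTE njb) add0r.
under eq_bigr => k _ do rewrite contr_scale.
rewrite mulrDr opprD; congr (_ + _).
  rewrite /bform /xcoef; case: eqP => _; last by rewrite mulr0 mul0r oppr0.
  rewrite mulrA mulrN !mulrA sgnM addbb mul1r mulNr opprK; ring.
transitivity (sgn (xpar Q a j && par b) * 
  - (sgn (xpar Q a j && par j) * dl Q a j (fun v => h (b :: v)) t)).
  ring.
rewrite IHt // mulr_sumr; apply: eq_bigr => k _; rewrite !add0n !contr_scale.
rewrite /xpar; case: (par a); case: (par b); case: (par j); rewrite /=; ring.
Qed.

End Contractions.

Definition infinite_alphabet (L : eqType) : Prop :=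
  forall s : seq L, exists a, a \notin s.

Lemma drop_catl (T : Type) q (s t : seq T) :
  (q <= size s)%N -> drop q (s ++ t) = drop q s ++ t.
Proof.
rewrite leq_eqVlt => /predU1P[->|qs]; last by rewrite drop_cat qs.
by rewrite drop_size_cat // drop_size.
Qed.

(** * Invariant functionals *)

Section Invariants.
Variables (K : fieldType) (L : choiceType) (Q : superform K L).
Notation par := (par Q).
Notation bar := (bar Q).
Notation eps := (eps Q).
Notation sgn := (@sgn K).
Notation sgnM := (@sgnM K).
Implicit Types (a b i j l : L) (w z u v : seq L) (f F G : seq L -> K).
Implicit Types (k m n q : nat).

Definition dl_inv n f : Prop := forall i j z, size z = n -> dl Q i j f z = 0.

(* Holds for the functional attached to an operator, the first [q] letters being *)
(* those of the output: no output letter is contracted with another one. *)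
Definition left_bound n q f : Prop :=
  forall z a, size z = n -> a \in take q z -> bar a \notin drop q z -> f z = 0.

(** For fresh [j], the coefficient functional of the contraction with position [k] when an invariant
    [f] is expanded along its first letter. *)
Definition link j k f z : K := (eps j)^-1 * paste Q k j (fun v => f (j :: v)) z.

Lemma sgn_neq0 s : sgn s != 0.
Proof. by case: s; rewrite ?oppr_eq0 oner_neq0. Qed.

(** Invariance under [x_aj] at the word [j :: w]: the first letter contributes [f (a :: w)], and the
    action on [w] is a sum of contractions by [dl_contr_sum]. *)
Lemma dl_inv_expand n f a j w :
  dl_inv n.+1 f -> size w = n -> j \notin w -> j != bar a ->
  f (a :: w) = \sum_(k < n) contr Q k a (link j k f) w.
Proof.
move=> fI sw jw ja; have := fI a j (j :: w); rewrite /= eqxx (negbTE ja) addr0.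
rewrite sw => /(_ erefl)/eqP; rewrite addr_eq0 dl_contr_sum // => /eqP ->.
by rewrite sw.
Qed.

(* Expand the left-hand side along the letter [l], with [j] as fresh letter. *)
Lemma link_indep_neq n f k j l z :
  dl_inv n.+2 f -> size z = n -> (k <= n)%N ->
  j \notin z -> bar l \notin z -> j != bar l ->
  link l k f z = link j k f z.
Proof.
move=> fI sz kn jz lz jl; rewrite {1}/link.
rewrite (@paste_ext _ _ _ _ _ _ (fun v => \sum_(m < n.+1) contr Q m l (link j m f) v)).
  rewrite paste_sum (bigD1 (Ordinal (kn : (k < n.+1)%N))) //= big1 => [|m mk].
    by rewrite contr_paste_fresh ?sz // eqxx addr0 mulKf ?eps_neq0.
  rewrite contr_paste_fresh ?sz //; case: eqP => // e.
  by case/eqP: mk; apply: val_inj.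
move=> v sv hv; apply: dl_inv_expand => //; first by rewrite sv sz.
by apply: contra jz => /hv; rewrite inE (negbTE jl).
Qed.

Hypothesis Linf : infinite_alphabet L.

Lemma fresh_letter (s : seq L) : {j | j \notin s /\ bar j \notin s}.
Proof.
apply: cid; have [j] := Linf (s ++ map bar s); rewrite mem_cat negb_or => /andP[js jbs].
by exists j; split=> //; apply: contra jbs => /(map_f bar); rewrite barK.
Qed.

Definition fresh (s : seq L) : L := sval (fresh_letter s).

Lemma freshP (s : seq L) : fresh s \notin s /\ bar (fresh s) \notin s.
Proof. exact: svalP (fresh_letter s). Qed.

(** Both sides are compared with a third letter, which removes the condition [j != bar l] of
    [link_indep_neq]. *)
Lemma link_indep n f k j l z :
  dl_inv n.+2 f -> size z = n -> (k <= n)%N ->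
  bar j \notin z -> bar l \notin z ->
  link l k f z = link j k f z.
Proof.
move=> fI sz kn jz lz; have [] := freshP [:: bar j, bar l & z].
set t := fresh _; rewrite !inE !negb_or => /and3P[tj tl tz] _.
by rewrite !(@link_indep_neq n _ _ t).
Qed.

Definition glink k f z : K := link (fresh z) k f z.

Lemma glinkE n f k j z :
  dl_inv n.+2 f -> size z = n -> (k <= n)%N -> bar j \notin z ->
  glink k f z = link j k f z.
Proof. by move=> *; apply: link_indep; eauto; case: (freshP z). Qed.

(** A letter [t] unrelated to [i], [j] and [z] makes [x_ij] commute, up to sign, with prefixing [t]
    and pasting [bar t], so the invariance of [f] descends. *)
Lemma glink_inv n f k : dl_inv n.+2 f -> (k <= n)%N -> dl_inv n (glink k f).
Proof.
move=> fI kn i j z sz; have [] := freshP [:: i, j, bar i, bar j & z].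
set t := fresh _; rewrite !inE !negb_or => /and5P[ti tj tbi tbj tz] /and5P[bti btj _ _ btz].
have bt b : b \in [:: i; j; bar i; bar j] -> (bar t == b) = false.
  rewrite !inE => /or4P[]/eqP->; rewrite ?(negbTE bti) ?(negbTE btj) //;
  by rewrite (inj_eq (@bar_inj _ _ Q)); apply/negbTE.
(* [bar t] is absent from every word of [x_ij z], so the single letter [t] computes [glink] on all
   of them. *)
rewrite (@dl_ext _ _ _ _ _ _ (link t k f)) => [|v sv hv]; last first.
  apply: glinkE fI _ kn _; rewrite ?sv //; apply: (contra (hv _)).
  by rewrite !inE !bt ?inE ?eqxx ?orbT.
rewrite /link dl_scale paste_dl //.
rewrite (@paste_ext _ _ _ _ _ _ (fun=> 0)) ?paste_0 ?mulr0 // => v sv _.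
have := fI i j (t :: v) _; rewrite /= (negbTE tj) (negbTE tbi) !add0r sv sz.
by move=> /(_ erefl)/eqP; rewrite mulf_eq0 (negbTE (sgn_neq0 _)) => /eqP.
Qed.

Lemma glinkE_cat n f k z :
  size z = n -> (k <= n)%N ->
  exists c, glink k f z =
    c * f (fresh z :: take k z ++ bar (fresh z) :: drop k z).
Proof.
move=> sz kn; rewrite /glink /link pasteE ?sz // mulrA.
by eexists.
Qed.

(** Here [bar j] is pasted among the input letters, so an output letter without partner in [z] has
    none in the longer word either. *)
Lemma glink_bound n q f k : left_bound n.+2 q f -> (q.-1 <= k <= n)%N ->
  left_bound n q.-1 (glink k f).
Proof.
case: q => [|q] fB /andP[/= qk kn] z a sz; first by rewrite take0.
move=> az bz; have [c ->] := glinkE_cat f sz kn.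
have [jz bjz] := freshP z; move: (fresh z) jz bjz => j jz bjz.
have kz : (k <= size z)%N by rewrite sz.
rewrite (fB _ a) ?mulr0 //=.
- by rewrite size_cat /= size_take_min size_drop sz; lia.
- rewrite inE takel_cat ?size_takel // take_takel // az orbT //.
- have nj : bar a != bar j.
    rewrite (inj_eq (@bar_inj _ _ Q)); apply: contra jz => /eqP <-.
    exact: mem_take az.
  move: bz; rewrite drop_catl ?size_takel // -{1}(cat_take_drop k z).
  by rewrite drop_catl ?size_takel // !mem_cat inE (negbTE nj).
Qed.

(** Here [bar j] is pasted among the output letters, so the leading output letter [j] has no partner
    in the input. *)
Lemma glink_zero n q f k z : left_bound n.+2 q f -> (k < q.-1)%N -> (k <= n)%N ->
  size z = n -> glink k f z = 0.
Proof.
case: q => // q fB /= kq kn sz; have [c ->] := glinkE_cat f sz kn.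
have [jz bjz] := freshP z; move: (fresh z) jz bjz => j jz bjz.
rewrite (fB _ j) ?mulr0 ?inE ?eqxx //=.
  by rewrite size_cat /= size_take_min size_drop sz; lia.
have kz : (k <= size z)%N by rewrite sz.
rewrite drop_cat size_takel // ltnNge (ltnW kq) /= -(subnSK kq) /=.
by apply: contra bjz => /mem_drop/mem_drop.
Qed.

(** If the unmatched output letter is [b] itself, the contraction with an input position vanishes;
    otherwise it stays unmatched in the shorter word, where [G] vanishes. *)
Lemma contr_bound n q k b G w a :
  (q.-1 <= k)%N -> left_bound n q.-1 G -> size w = n.+1 ->
  a \in take q (b :: w) -> bar a \notin drop q (b :: w) -> contr Q k b G w = 0.
Proof.
case: q => [|q] //= qk GB sw.
rewrite inE => /orP ab bw.
have [kw|wk] := ltnP k (size w); last exact: contr_over.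
have [c [-> cb]] := contrE Q b G kw.
case: ab => [/eqP e|aw].
  rewrite cb ?mul0r //; apply: contraNneq bw => eb.
  have -> : bar a = nth b w k by rewrite eb e.
  rewrite -(subnKC qk) -nth_drop mem_nth // size_drop.
  by rewrite ltn_sub2r ?(leq_ltn_trans qk) //.
rewrite (GB _ a) ?mulr0 //.
- rewrite size_cat size_takel 1?ltnW // size_drop; lia.
- by rewrite takel_cat ?take_takel ?size_takel ?(ltnW kw).
move: bw; rewrite -{1}(cat_take_drop k w) !drop_catl ?size_takel ?(ltnW kw) //.
rewrite !mem_cat; apply: contra => /orP[->//|]; rewrite -add1n -drop_drop => /mem_drop ->.
by rewrite orbT.
Qed.

End Invariants.

(** * Extension of invariant functionals to a larger alphabet *)

Record form_embedding (K : fieldType) (S L : choiceType)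
    (QS : superform K S) (QL : superform K L) (e : S -> L) : Prop :=
  FormEmbedding {
    emb_inj : injective e;
    emb_par : forall a, par QL (e a) = par QS a;
    emb_bar : forall a, bar QL (e a) = e (bar QS a);
    emb_eps : forall a, eps QL (e a) = eps QS a
  }.

Section Extension.
Variables (K : fieldType) (S L : choiceType).
Variables (QS : superform K S) (QL : superform K L) (e : S -> L).
Hypothesis (eE : form_embedding QS QL e).
Hypothesis Sinf : infinite_alphabet S.

Lemma contr_map k a G (w : seq S) :
  contr QL k (e a) G (map e w) = contr QS k a (fun z => G (map e z)) w.
Proof.
elim: k w G => [|k IHk] [|b t] G //=.
  by rewrite /bform (emb_eps eE) (emb_bar eE) (inj_eq (emb_inj eE)).
by rewrite IHk !(emb_par eE).
Qed.

(** Strong induction on the length: the functionals [glink k f] live on words shorter by two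
    letters, and their extensions are reassembled by contracting the first letter. The bound is
    carried along because it later confines the outputs of an operator to finitely many words. *)
Lemma invariant_extension n q (f : seq S -> K) :
  dl_inv QS n f -> left_bound QS n q f ->
  exists F : seq L -> K, [/\ forall z, size z = n -> F (map e z) = f z,
    dl_inv QL n F & left_bound QL n q F].
Proof.
elim/ltn_ind: n q f => -[|n] IHn q f fI fB.
  exists (fun=> f [::]); split=> [z /size0nil ->|i j z /size0nil ->|z a /size0nil ->] //.
(* The range of [k] is a premise so that [choice] applies to all [k]; outside it, [G] is 0. *)
have /choice[G GP] : forall k, exists G : seq L -> K, (k < n)%N -> (q.-1 <= k)%N ->
    [/\ forall z, size z = n.-1 -> G (map e z) = glink QS Sinf k f z,
    dl_inv QL n.-1 G & left_bound QL n.-1 q.-1 G].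
  move=> k; have [kn|nk] := ltnP k n; last by exists (fun=> 0).
  have [qk|kq] := leqP q.-1 k; last by exists (fun=> 0).
  case: n kn IHn fI fB => // n kn IHn fI fB.
  have qkn : (q.-1 <= k <= n)%N by rewrite qk.
  have [] // := IHn n _ q.-1 (glink QS Sinf k f); [exact: glink_inv|exact: glink_bound|].
  by move=> G GP; exists G.
(* Positions below [q.-1] hold output letters, where [glink] vanishes by [glink_zero]. *)
pose F z := if z is a :: w then
  \sum_(k < n | (q.-1 <= k)%N) contr QL k a (G k) w else 0.
exists F; split=> [z|i j z|z a].
- case: z => [|a w] // [sw] /=; have [] := freshP QS Sinf (bar QS a :: w).
  move: (fresh _ _ _) => j; rewrite !inE !negb_or => /andP[ja jw] /andP[_ bjw].
  rewrite (dl_inv_expand fI sw jw ja) big_mkcond /=; apply: eq_bigr => k _.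
  have kn := ltn_ord k; rewrite contr_map.
  case: n k IHn kn fI fB GP sw @F => // n k _ kn fI fB GP sw _.
  have linkE v : size v = n -> {subset v <= w} ->
      link QS j k f v = glink QS Sinf k f v.
    by move=> sv hv; rewrite (glinkE _ fI sv kn (j := j)) //; apply: contra (hv _) _.
  have [qk|kq] := leqP q.-1 k.
    have [GE _ _] := GP k kn qk.
    by apply: contr_ext => v; rewrite sw => sv hv; rewrite GE // linkE.
  rewrite -(contr_0 QS k a w); apply: contr_ext => v; rewrite sw => sv hv.
  by rewrite linkE // (glink_zero _ fB kq kn sv).
(* By [contr_dl], [x_ij] passes through each contraction to the invariant functional [G k]. *)
- case: z => [|a w] // [sw].
  rewrite (@dl_ext _ _ _ _ _ _ (fun z => \sum_(k < n | (q.-1 <= k)%N)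
    if z is a :: w then contr QL k a (G k) w else 0)) => [|[|b t] _ _]; last first.
  + by [].
  + by rewrite /F big1.
  rewrite dl_sum big1 // => k qk; rewrite /= contr_dl -(contr_0 QL k a w).
  by apply: contr_ext => v sv _; have [_ -> //] := GP k (ltn_ord k) qk; rewrite sv sw.
case: z => [|b w] // [sw] az bz; apply: big1 => k qk; have kn := ltn_ord k.
have [_ _ GB] := GP k kn qk.
case: n {IHn} k kn fI fB GP GB sw qk @F => // n k _ _ _ _ GB sw qk _.
exact: contr_bound qk GB sw az bz.
Qed.


End Extension.

(** * Equivariant operators on words *)

Section WordOperators.
Variables (K : fieldType) (L : choiceType) (Q : superform K L).
Notation par := (par Q).
Notation bar := (bar Q).
Notation eps := (eps Q).
Notation sgn := (@sgn K).
Notation sgnM := (@sgnM K).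
Notation T := {malg K[seq L]}.
Implicit Types (a b i j l : L) (w z u v : seq L) (F G : seq L -> K) (s t : T).

Definition lcons a : T -> T := lext (fun w => << a :: w >> : T).
HB.instance Definition _ a := GRing.Linear.copy (lcons a) (lext _).

Fixpoint xword i j w : T :=
  if w is a :: w' then
    (if a == j then << i :: w' >> else 0) +
    (if a == bar i then xcoef Q i j *: << bar j :: w' >> else 0) +
    sgn (xpar Q i j && par a) *: lcons a (xword i j w')
  else 0.

Definition xact i j : T -> T := lext (xword i j).
HB.instance Definition _ i j := GRing.Linear.copy (xact i j) (lext _).

Definition equivariant (h : T -> T) : Prop :=
  forall i j t, h (xact i j t) = xact i j (h t).

Lemma xactU i j w : xact i j << w >> = xword i j w.
Proof. exact: lextU. Qed.

Lemma mcoeffU_if w u : (<< w >> : T)@_u = if w == u then 1 else 0.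
Proof. by rewrite mcoeffU; case: eqP. Qed.

Lemma mcoeff_if (c : bool) t u : (if c then t else 0)@_u = if c then t@_u else 0.
Proof. by case: c; rewrite ?mcoeff0. Qed.

Lemma mcoeff_lcons a t b u : (lcons a t)@_(b :: u) = if a == b then t@_u else 0.
Proof.
elim/malg_ind: t => [|w|c s t es et].
- by rewrite linear0 !mcoeff0 if_same.
- by rewrite [lcons _ _]lextU !mcoeffU_if eqseq_cons; case: (a == b).
- by rewrite linearP !mcoeffD !mcoeffZ es et; case: ifP; rewrite ?mulr0 ?addr0.
Qed.

Lemma mcoeff_lcons0 a t : (lcons a t)@_[::] = 0.
Proof.
elim/malg_ind: t => [|w|c s t es et]; first by rewrite linear0 !mcoeff0.
  by rewrite [lcons _ _]lextU !mcoeffU_if.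
by rewrite linearP !mcoeffD !mcoeffZ es et mulr0 addr0.
Qed.

Lemma dr_lin i j c F G u :
  dr Q i j (fun v => c * F v + G v) u = c * dr Q i j F u + dr Q i j G u.
Proof.
elim: u F G => [|a w IHw] F G /=; first by rewrite mulr0 addr0.
by rewrite IHw; case: ifP => _; case: ifP => _; ring.
Qed.

Lemma dr_0 i j u : dr Q i j (fun=> 0) u = 0.
Proof.
elim: u => [|a w IHw] //=.
by rewrite IHw; case: ifP => _; case: ifP => _; ring.
Qed.

Lemma mcoeff_xact i j t u : (xact i j t)@_u = dr Q i j (fun v => t@_v) u.
Proof.
elim/malg_ind: t => [|w|c s t es et].
- rewrite linear0 mcoeff0 -[LHS](dr_0 i j u).
  by apply: dr_ext => v _; rewrite mcoeff0.
- rewrite xactU; elim: w u => [|a w IHw] [|b u] /=; rewrite ?mcoeff0 //.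
  + rewrite !mcoeffU_if !if_same.
    rewrite (@dr_ext _ _ _ _ _ _ (fun=> 0)) => [|v _]; last by rewrite mcoeffU_if.
    by rewrite dr_0 !mulr0 if_same !addr0.
  + rewrite !mcoeffD mcoeffZ mcoeff_lcons0 !mcoeff_if mcoeffZ !mcoeffU_if.
    by rewrite !mulr0 !if_same !addr0.
  + rewrite !mcoeffD mcoeffZ mcoeff_lcons !mcoeff_if mcoeffZ !mcoeffU_if.
    rewrite !eqseq_cons IHw.
    rewrite (@dr_ext _ _ _ _ _ (fun v => (<< a :: w >> : T)@_(b :: v))
      (fun v => (if a == b then 1 else 0) * (<< w >> : T)@_v + 0)); last first.
      move=> v _; rewrite !mcoeffU_if eqseq_cons addr0.
      by case: (a == b); rewrite ?mul1r ?mul0r.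
    rewrite dr_lin dr_0 addr0.
    rewrite (eq_sym b i) (eq_sym b (bar j)).
    congr (_ + _ + _).
    * by case: (i == b); case: (a == j).
    * by case: (bar j == b); case: (a == bar i); rewrite ?mulr0.
    * by case: eqP => [->|]; rewrite ?mul1r ?mul0r ?mulr0.
- rewrite linearP mcoeffD mcoeffZ es et -dr_lin.
  by apply: dr_ext => v _; rewrite mcoeffD mcoeffZ.
Qed.

Lemma mcoeff_lin_xact (h : {linear T -> T}) i j w u :
  (h (xact i j << w >>))@_u = dl Q i j (fun v => (h << v >>)@_u) w.
Proof.
rewrite xactU; elim: w h => [|a w IHw] h /=; first by rewrite linear0 mcoeff0.
rewrite !linearD linearZ !mcoeffD mcoeffZ.
have := IHw (h \o lcons a) => /= ->.
congr (_ + _ + _ * _); last by apply: dl_ext => v _ _; rewrite [lcons _ _]lextU.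
  by case: ifP; rewrite // linear0 mcoeff0.
by case: ifP; rewrite ?linear0 ?mcoeff0 // linearZ mcoeffZ.
Qed.

Lemma equivariantP (h : {linear T -> T}) :
  equivariant h <->
  forall i j w u, dl Q i j (fun v => (h << v >>)@_u) w =
                  dr Q i j (fun v => (h << w >>)@_v) u.
Proof.
split=> [hE i j w u|hE i j].
  by rewrite -mcoeff_lin_xact hE mcoeff_xact.
apply: (malg_linP (f := h \o xact i j) (h := xact i j \o h)) => w /=.
by apply/malgP => u; rewrite mcoeff_lin_xact hE mcoeff_xact.
Qed.

Lemma dl_notin i j F w : j \notin w -> bar i \notin w -> dl Q i j F w = 0.
Proof.
elim: w F => [|a w IHw] F //=; rewrite !inE !negb_or => /andP[ja jw] /andP[ia iw].
by rewrite eq_sym (negbTE ja) eq_sym (negbTE ia) IHw // mulr0 !addr0.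
Qed.

Lemma dr_notin i j G u : i \notin u -> (forall v, bar i \in v -> G v = 0) ->
  dr Q i j G u = 0.
Proof.
elim: u G => [|b u IHu] G //=; rewrite inE negb_or => /andP[ib iu] G0.
rewrite eq_sym (negbTE ib) G0 ?inE ?eqxx // mulr0 if_same.
by rewrite IHu ?mulr0 ?addr0 // => v iv; rewrite G0 // inE iv orbT.
Qed.

Hypothesis Linf : infinite_alphabet L.

(** If [a] occurs in [u] but not in [w], then [x_ia] with [i] fresh kills [w], while the coefficient
    of [x_ia (h w)] at [u] with one [a] replaced by [i] is, up to sign, that of [h w] at [u]. *)
Lemma equivariant_letters (h : {linear T -> T}) w u :
  equivariant h -> (h << w >>)@_u != 0 -> {subset u <= w}.
Proof.
move/equivariantP => hE hu a au; apply: contraNT hu => aw; apply/eqP.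
set G := fun v => (h << w >>)@_v; rewrite -/(G u).
(* Avoiding the support of [h w] excludes terms of [x_ia (h w)] in which [bar i] becomes [bar a]. *)
have [] := freshP Q Linf (bar a :: w ++ u ++ flatten (msupp (h << w >>))).
move: (fresh _ _ _) => i.
rewrite !inE !mem_cat !negb_or => /and4P[ia iw iu iG] /and4P[bia biw biu biG].
have G0 v : bar i \in v -> G v = 0.
  move=> iv; apply: mcoeff_outdom; apply: contra biG => vG.
  by apply/flattenP; exists v.
have := hE i a w; rewrite -/G => {}hE.
case/splitPr: au iu {biu} => u1 u2; rewrite mem_cat inE !negb_or => /and3P[iu1 _ iu2].
have := hE (u1 ++ i :: u2); rewrite dl_notin // dr_cat /= eqxx (negbTE ia).
rewrite dr_notin //; last by move=> v iv; rewrite G0 // mem_cat iv.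
rewrite dr_notin //; last by move=> v iv; rewrite G0 // mem_cat inE iv !orbT.
rewrite mulr0 !addr0 add0r => /esym/eqP.
by rewrite mulf_eq0 (negbTE (sgn_neq0 _ _)) => /eqP.
Qed.

Definition dual w : seq L := rev (map bar w).

Definition epsprod w : K := \prod_(a <- w) eps a.

Lemma dualK : involutive dual.
Proof.
by move=> w; rewrite /dual map_rev revK -map_comp map_id_in // => a _; exact: barK.
Qed.

Lemma size_dual w : size (dual w) = size w.
Proof. by rewrite size_rev size_map. Qed.

Lemma mem_dual a w : (a \in dual w) = (bar a \in w).
Proof. by rewrite mem_rev -{1}(barK Q a) mem_map //; exact: bar_inj. Qed.

Lemma epsprod_neq0 w : epsprod w != 0.
Proof. by rewrite prodf_seq_neq0; apply/allP => a _; rewrite eps_neq0. Qed.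

Lemma wpar_dual w : wpar Q (dual w) = wpar Q w.
Proof.
rewrite /dual; elim: w => //= a w IHw; rewrite rev_cons -cats1 wpar_cat IHw /=.
by rewrite addbF par_bar addbC.
Qed.

(** Since the form is invariant, [x_ij] on the dual word is minus the transpose of [x_ij] on the
    output, up to the sign for passing [v]. *)
Lemma dl_dual i j G v :
  dl Q i j (fun v => epsprod v * G (dual v)) v =
  - (sgn (xpar Q i j && wpar Q v) * epsprod v * dr Q i j G (dual v)).
Proof.
have dual_cons a w : dual (a :: w) = dual w ++ [:: bar a].
  by rewrite /dual /= rev_cons -cats1.
elim: v G => [|a v IHv] G /=; first by rewrite mulr0 oppr0.
rewrite (@dl_ext _ _ _ _ _ (fun v0 => epsprod (a :: v0) * G (dual (a :: v0)))
  (fun v => eps a * (epsprod v * G (dual v ++ [:: bar a])))) => [|z _ _]; last first.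
  by rewrite /epsprod big_cons dual_cons mulrA.
rewrite dl_scale (IHv (fun z => G (z ++ [:: bar a]))) !dual_cons dr_cat /= !barK.
rewrite /epsprod !big_cons wpar_dual !mulr0 !addr0.
rewrite -/(epsprod v) sgn_addb.
have e1 := xcoef_inv1 Q i j; have e2 := xcoef_inv2 Q i j.
rewrite bar_eq (inj_eq (@bar_inj _ _ Q)).
have ss x : sgn x * sgn x = 1 by rewrite sgnM addbb.
set sv := sgn (_ && wpar Q v); set sa := sgn (_ && par a).
have E1 X : (if a == j then eps i * epsprod v * X else 0) =
    - (sa * eps a * epsprod v * if a == j then xcoef Q i j * X else 0).
  case: eqP => [ej|_]; last by rewrite mulr0 oppr0.
  by rewrite -[eps i]opprK -e1 /sa ej; ring.
have E2 X : (if a == bar i then xcoef Q i j * (eps (bar j) * epsprod v * X) else 0) =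
    - (sa * eps a * epsprod v * if a == bar i then X else 0).
  case: eqP => [ei|_]; last by rewrite mulr0 oppr0.
  by rewrite !mulrA e2 /sa ei par_bar; ring.
rewrite E1 E2.
move: (if a == j then _ else _) (if a == bar i then _ else _) (dr _ _ _ _ _) => X1 X2 X3.
have -> : sa * sv * (eps a * epsprod v) * (X3 + sv * (X2 + X1)) =
  sa * sv * (eps a * epsprod v) * X3 + sa * (sv * sv) * (eps a * epsprod v) * (X2 + X1).
  by ring.
by rewrite ss; ring.
Qed.

(* The functional [v ++ w |-> <v, h w>], [v] being the prefix of length [q]; the *)
(* pairing contracts the last letter of [v] with the first one of [h w] and so on, *)
(* hence involves no sign. *)
Definition pairing q (h : T -> T) z : K :=
  epsprod (take q z) * (h << drop q z >>)@_(dual (take q z)).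

(** In the Leibniz rule, the prefix contributes minus the action on the output of [h] by [dl_dual],
    and the suffix the action on its input; equivariance makes them cancel. *)
Lemma pairing_inv p q (h : {linear T -> T}) :
  equivariant h -> dl_inv Q (q + p) (pairing q h).
Proof.
move=> /equivariantP hE i j z sz; have qz : (q <= size z)%N by rewrite sz leq_addr.
rewrite -{1}(cat_take_drop q z) dl_cat.
have st := size_takel qz; set v := take q z in st *; set w := drop q z.
rewrite (@dl_ext _ _ _ _ _ _
  (fun v => epsprod v * (h << w >>)@_(dual v))) => [|u su _]; last first.
  by rewrite /pairing take_size_cat ?drop_size_cat // su.
rewrite (dl_dual i j (fun u => (h << w >>)@_u)) -hE.
rewrite (@dl_ext _ _ _ _ _ (fun w' => pairing q h (v ++ w'))
  (fun w => epsprod v * (h << w >>)@_(dual v))) => [|u su _]; last first.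
  by rewrite /pairing take_size_cat ?drop_size_cat.
by rewrite dl_scale; ring.
Qed.

Lemma pairing_bound n q (h : {linear T -> T}) :
  equivariant h -> left_bound Q n q (pairing q h).
Proof.
move=> hE z a sz az bz; rewrite /pairing.
have [->|/(equivariant_letters hE)/(_ (bar a))] :=
  eqVneq (h << drop q z >>)@_(dual (take q z)) 0.
  by rewrite mulr0.
by rewrite mem_dual barK (negbTE bz) => /(_ az).
Qed.


End WordOperators.

Lemma bounded_words (L : eqType) (w : seq L) r :
  exists s : seq (seq L), forall u, {subset u <= w} -> (size u <= r)%N -> u \in s.
Proof.
elim: r => [|r [s sP]].
  by exists [:: [::]] => u _; rewrite leqn0 size_eq0 inE.
exists ([::] :: [seq a :: v | a <- w, v <- s]) => -[|a u] // uw ur.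
rewrite inE; apply/allpairsP; exists (a, u); split=> //=.
  by apply: uw; rewrite inE eqxx.
by apply: sP => // b bu; apply: uw; rewrite inE bu orbT.
Qed.

Lemma finite_malg (K : fieldType) (I : choiceType) (f : I -> K) (s : seq I) :
  (forall k, f k != 0 -> k \in s) -> exists t : {malg K[I]}, forall k, t@_k = f k.
Proof.
move=> fs; exists (\sum_(k <- undup s) f k *: << k >>) => k.
rewrite raddf_sum /=; under eq_bigr => l _ do rewrite mcoeffZ mcoeffU.
case: (boolP (k \in undup s)) => ks.
  rewrite (bigD1_seq k) ?undup_uniq //= eqxx mulr1 big1 ?addr0 // => l /negbTE ->.
  by rewrite mulr0.
rewrite big1_seq => [|l /andP[_ ls]].
  by apply/esym/eqP; apply: contraNT ks => /fs; rewrite mem_undup.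
by case: eqP ls ks => [->->|] //; rewrite mulr0.
Qed.

(** * Extension of operators and its uniqueness *)

Section OperatorExtension.
Variables (K : fieldType) (S L : choiceType).
Variables (QS : superform K S) (QL : superform K L) (e : S -> L).
Hypothesis (eE : form_embedding QS QL e).
Hypothesis Sinf : infinite_alphabet S.
Notation TS := {malg K[seq S]}.
Notation TL := {malg K[seq L]}.

Definition memb : TS -> TL := lext (fun w => << map e w >> : TL).
HB.instance Definition _ := GRing.Linear.copy memb (lext _).

Lemma membU w : memb << w >> = << map e w >>.
Proof. exact: lextU. Qed.

Lemma mcoeff_memb t w : (memb t)@_(map e w) = t@_w.
Proof.
elim/malg_ind: t => [|v|c s t es et]; first by rewrite linear0 !mcoeff0.
  by rewrite membU !mcoeffU_if (inj_eq (inj_map (emb_inj eE))).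
by rewrite linearP !mcoeffD !mcoeffZ es et.
Qed.

Lemma mcoeff_memb_out t u : (forall w, u <> map e w) -> (memb t)@_u = 0.
Proof.
move=> hu; elim/malg_ind: t => [|v|c s t es et]; first by rewrite linear0 !mcoeff0.
  by rewrite membU !mcoeffU_if; case: eqP => // /esym /hu.
by rewrite linearP !mcoeffD !mcoeffZ es et mulr0 addr0.
Qed.

Lemma memb_inj : injective memb.
Proof. by move=> s t st; apply/malgP => w; rewrite -!mcoeff_memb st. Qed.

Lemma xcoef_emb i j : xcoef QL (e i) (e j) = xcoef QS i j.
Proof. by rewrite /xcoef /xpar !(emb_par eE) !(emb_eps eE). Qed.

Lemma memb_xact i j t : memb (xact QS i j t) = xact QL (e i) (e j) (memb t).
Proof.
apply: (malg_linP (f := memb \o xact QS i j) (h := xact QL (e i) (e j) \o memb)).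
move=> w /=; rewrite membU !xactU; elim: w => [|a w IHw] /=; first by rewrite linear0.
rewrite !linearD !linearZ (inj_eq (emb_inj eE)) (emb_bar eE) (inj_eq (emb_inj eE)).
rewrite /xpar !(emb_par eE) -IHw xcoef_emb (emb_bar eE).
congr (_ + _ + _ *: _); rewrite /=.
- by case: ifP => _; rewrite ?linear0 ?membU.
- by case: ifP => _; rewrite ?linear0 // linearZ /= membU.
by apply: (malg_linP (f := memb \o lcons a) (h := lcons (e a) \o memb)) => v /=;
  rewrite membU /lcons !lextU membU.
Qed.

Lemma words_of_emb (u : seq L) :
  (forall a, a \in u -> exists s, a = e s) -> exists w, u = map e w.
Proof.
elim: u => [|a u IHu] hu; first by exists [::].
have [|w ->] := IHu; first by move=> b bu; apply: hu; rewrite inE bu orbT.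
by have [|s ->] := hu a; rewrite ?inE ?eqxx //; exists (s :: w).
Qed.

Lemma sub_map_emb (u : seq L) w : {subset u <= map e w} -> exists v, u = map e v.
Proof. by move=> uw; apply: words_of_emb => a /uw /mapP[s _ ->]; exists s. Qed.

(** As [j] is absent from [w], [x_ij] only creates letters [bar j], which [N] does not count, so the
    count cannot grow. *)
Lemma dl_small (N : pred L) i j F (w : seq L) :
  j \notin w -> ~~ N (bar QL j) ->
  (forall v, (count N v <= count N w)%N -> F v = 0) -> dl QL i j F w = 0.
Proof.
move=> + Nj; elim: w F => [|a w IHw] F //=.
rewrite inE negb_or => /andP[ja jw] F0.
rewrite eq_sym (negbTE ja) F0 /= ?(negbTE Nj) ?leq_addl // mulr0 if_same.
by rewrite IHw ?mulr0 ?addr0 // => v vw; rewrite F0 //= leq_add2l.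
Qed.

(* A letter outside [S] is the image of a fresh letter of [S] under an *)
(* infinitesimal operator, whose other terms have fewer letters outside [S]. *)
Lemma equivariant_eq0 (h : {linear TL -> TL}) :
  equivariant QL h -> (forall w, h << map e w >> = 0) -> forall t, h t = 0.
Proof.
move=> /equivariantP hE h0.
apply: (malg_linP (f := h) (h := \0)) => w /=.
pose N a := ~~ `[< exists s, a = e s >].
have [n] := ubnP (count N w); elim: n w => // n IHn w wn.
have [/hasP[a aw Na]|] := boolP (has N w); last first.
  rewrite -all_predC => /allP hw; have [|v ->] := @words_of_emb w; last exact: h0.
  by move=> a /hw /=; rewrite negbK => /asboolP.
case/splitPr: aw wn => w1 w2; rewrite count_cat /= Na ltnS => wn.
have eN s : ~~ N (e s) by rewrite negbK; apply/asboolP; exists s.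
have [j [jw nj nbj]] : exists j, [/\ j \notin w1 ++ w2, ~~ N j & ~~ N (bar QL j)].
  (* The list of preimages in [S] of the letters of the word, so that [e s] does not occur in it. *)
  have [s sw] := Sinf (pmap (fun a => if pselect (exists s, a = e s) is left ex
    then Some (sval (cid ex)) else None) (w1 ++ w2)).
  exists (e s); split; rewrite ?(emb_bar eE) //; apply: contra sw => sw.
  rewrite mem_pmap; apply/mapP; exists (e s) => //.
  case: pselect => [ex|[]]; last by exists s.
  by case: (cid ex) => s' /= /(emb_inj eE) ->.
move: jw; rewrite mem_cat negb_or => /andP[jw1 jw2].
apply/malgP => u; rewrite mcoeff0.
have := hE a j (w1 ++ j :: w2) u.
have F0 v : (count N v < n)%N -> (h << v >>)@_u = 0.
  by move=> /IHn -> ; rewrite mcoeff0.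
have small : (count N w1 + count N w2 < n)%N by move: wn; rewrite addnS.
rewrite [RHS](_ : _ = 0); last first.
  rewrite IHn ?count_cat /= ?(negbTE nj) // -[RHS](dr_0 QL a j u).
  by apply: dr_ext => v _; rewrite mcoeff0.
rewrite dl_cat (@dl_small N a j _ w1) //; last first.
  move=> v vw; rewrite F0 // count_cat /= (negbTE nj) add0n.
  by apply: leq_ltn_trans small; rewrite leq_add2r.
rewrite /= eqxx (@dl_small N a j _ w2) //; last first.
  move=> v vw; rewrite F0 // count_cat /= (negbTE nj) add0n.
  by apply: leq_ltn_trans small; rewrite leq_add2l.
case: eqP => [ej|_]; first by rewrite ej barK Na in nbj.
rewrite mulr0 !addr0 add0r => /eqP.
by rewrite mulf_eq0 (negbTE (sgn_neq0 _ _)) => /eqP.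
Qed.

Definition bounded_op (r : nat) (I : choiceType)
    (h : {malg K[seq I]} -> {malg K[seq I]}) : Prop :=
  forall w u, (h << w >>)@_u != 0 -> (size w <= r)%N /\ (size u <= r)%N.

(** Each block of [h], from words of length [p] to words of length [q], is encoded as the functional
    [pairing q h] on words of length [q + p]. That functional is extended and decoded into the
    coefficients of [H]. *)
Lemma operator_extension r (h : {linear TS -> TS}) :
  equivariant QS h -> bounded_op r h ->
  exists H : {linear TL -> TL}, [/\ equivariant QL H,
    forall t, H (memb t) = memb (h t), bounded_op r H &
    forall w u, (H << w >>)@_u != 0 -> {subset u <= w}].
Proof.
move=> hE hr.
have /choice[F0 F0P] : forall q, exists F : nat -> seq L -> K, forall p,
    [/\ forall z, size z = (q + p)%N -> F p (map e z) = pairing QS q h z,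
    dl_inv QL (q + p) (F p) & left_bound QL (q + p) q (F p)].
  move=> q; suff /choice[F FP] : forall p, exists F : seq L -> K,
      [/\ forall z, size z = (q + p)%N -> F (map e z) = pairing QS q h z,
      dl_inv QL (q + p) F & left_bound QL (q + p) q F] by exists F.
  move=> p; apply: (invariant_extension eE Sinf); first exact: pairing_inv.
  exact: pairing_bound.
(* This inverts [pairing], whose prefix is the dual of the output word; beyond length [r] the
   coefficients are set to 0. *)
pose c w u := if (size w <= r)%N && (size u <= r)%N then
  (epsprod QL (dual QL u))^-1 * F0 (size u) (size w) (dual QL u ++ w) else 0.
(* By [left_bound], the letters of [u] occur in [w], so [c w] has finite support and defines a
   vector. *)
have c_sub w u : c w u != 0 -> [/\ {subset u <= w}, (size w <= r)%N & (size u <= r)%N].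
  rewrite /c; case: ifP => [/andP[wr ur] cn|]; last by rewrite eqxx.
  split=> // a au; apply: contraNT cn => aw; apply/eqP.
  have [_ _ FB] := F0P (size u) (size w).
  rewrite (FB _ (bar QL a)) ?mulr0 ?size_cat ?size_dual //.
    by rewrite take_size_cat ?size_dual // mem_dual barK.
  by rewrite drop_size_cat ?size_dual // barK.
have /choice[H0 H0E] : forall w, exists t : TL, forall u, t@_u = c w u.
  move=> w; have [s sP] := bounded_words w r.
  by apply: (finite_malg (s := s)) => u /c_sub[uw _ ur]; exact: sP.
pose H : {linear TL -> TL} := lext H0.
have HE w u : (H << w >>)@_u = c w u by rewrite [H _]lextU.
exists H; split.
- apply/equivariantP => i j w u.
  rewrite (@dl_ext _ _ _ _ _ _ (c^~ u)) => [|v _ _]; last exact: HE.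
  rewrite (@dr_ext _ _ _ _ _ _ (c w)) => [|v _]; last exact: HE.
  (* [x_ij] preserves lengths, so both sides vanish as soon as one length exceeds [r]. *)
  have [wr|wr] := leqP (size w) r; last first.
    rewrite (@dl_ext _ _ _ _ _ _ (fun=> 0)) => [|v vw _]; last first.
      by rewrite /c vw leqNgt wr.
    rewrite dl_0 (@dr_ext _ _ _ _ _ _ (fun=> 0)) ?dr_0 // => v _.
    by rewrite /c leqNgt wr.
  have [ur|ur] := leqP (size u) r; last first.
    rewrite (@dl_ext _ _ _ _ _ _ (fun=> 0)) => [|v vw _]; last first.
      by rewrite /c andbC leqNgt ur.
    rewrite dl_0 (@dr_ext _ _ _ _ _ _ (fun=> 0)) ?dr_0 // => v vu.
    by rewrite /c andbC vu leqNgt ur.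
  pose F := F0 (size u) (size w).
  rewrite (@dl_ext _ _ _ _ _ _ (fun w => (epsprod QL (dual QL u))^-1 *
    F (dual QL u ++ w))) => [|v vw _]; last by rewrite /c vw wr ur.
  pose G u := (epsprod QL (dual QL u))^-1 * F (dual QL u ++ w).
  rewrite (@dr_ext _ _ _ _ _ _ G) => [|v vu]; last by rewrite /c vu wr ur.
  have [_ FI _] := F0P (size u) (size w).
  (* The invariance of [F] splits into the actions on [dual u] and on [w]; [dl_dual] turns the first
     into minus the [dr] term. *)
  have := FI i j (dual QL u ++ w); rewrite size_cat size_dual => /(_ erefl).
  rewrite -/F dl_cat (@dl_ext _ _ _ _ _ (fun v => F (v ++ w))
    (fun v => epsprod QL v * G (dual QL v))); last first.
    by move=> v _ _; rewrite /G dualK mulrA divff ?mul1r // epsprod_neq0.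
  rewrite dl_dual dualK dl_scale -mulrA -mulrN -mulrDr => /eqP.
  rewrite mulf_eq0 (negbTE (sgn_neq0 _ _)) addrC subr_eq0 => /eqP ->.
  by rewrite mulKf // epsprod_neq0.
- apply: (malg_linP (f := H \o memb) (h := memb \o h)) => w /=.
  rewrite membU; apply/malgP => u; rewrite HE.
  (* For [u] not a word in [S], the left coefficient vanishes because output letters of [H] occur in
     the input. *)
  have [[v ->]|nu] := pselect (exists v, u = map e v); last first.
    rewrite mcoeff_memb_out => [|v uv]; last by case: nu; exists v.
    by apply: contra_notP nu => /eqP/c_sub[/sub_map_emb].
  rewrite mcoeff_memb /c !size_map.
  case: ifP => [_|/negP wv]; last first.
    by apply/esym/eqP; apply: contra_notT wv => /hr[-> ->].
  have -> : dual QL (map e v) = map e (dual QS v).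
    rewrite /dual map_rev -!map_comp; congr (rev _).
    by apply: eq_map => a /=; rewrite (emb_bar eE).
  have -> : epsprod QL (map e (dual QS v)) = epsprod QS (dual QS v).
    by rewrite /epsprod big_map; apply: eq_bigr => a _; rewrite (emb_eps eE).
  have [FE _ _] := F0P (size v) (size w).
  rewrite -map_cat FE ?size_cat ?size_dual // /pairing.
  by rewrite take_size_cat ?drop_size_cat ?size_dual // dualK mulKf ?epsprod_neq0.
- by move=> w u; rewrite HE => /c_sub[].
- by move=> w u; rewrite HE => /c_sub[].
Qed.

End OperatorExtension.

#[local] Opaque lext.

(** * Transfer of operators between two alphabets *)

Section Transfer.
Variables (K : fieldType) (S1 S2 L : choiceType).
Variables (Q1 : superform K S1) (Q2 : superform K S2) (QL : superform K L).
Variables (e1 : S1 -> L) (e2 : S2 -> L).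
Hypothesis (e1E : form_embedding Q1 QL e1) (e2E : form_embedding Q2 QL e2).
Hypothesis S1inf : infinite_alphabet S1.

Lemma memb_surj (y : {malg K[seq L]}) :
  (forall u, y@_u != 0 -> exists v, u = map e2 v) ->
  exists t : {malg K[seq S2]}, memb e2 t = y.
Proof.
move=> yP; rewrite (malg_basisE y) big_seq.
elim/big_ind: _ => [|_ _ [s <-] [t <-]|u]; first by exists 0; rewrite linear0.
  by exists (s + t); rewrite linearD.
rewrite -mcoeff_neq0 => /yP[v uv].
by exists (y@_u *: << v >>); rewrite linearZ /= membU uv.
Qed.

(** The extension of [h1] to [L] restricts to words in [S2], since its output letters always occur
    in the input. *)
Lemma operator_transfer r (h1 : {linear {malg K[seq S1]} -> {malg K[seq S1]}}) :
  equivariant Q1 h1 -> bounded_op r h1 ->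
  exists (H : {linear {malg K[seq L]} -> {malg K[seq L]}})
    (h2 : {linear {malg K[seq S2]} -> {malg K[seq S2]}}),
  [/\ equivariant QL H, equivariant Q2 h2, bounded_op r h2,
    forall t, H (memb e1 t) = memb e1 (h1 t) &
    forall t, H (memb e2 t) = memb e2 (h2 t)].
Proof.
move=> h1E h1r; have [H [HE H1 Hr Hsub]] := operator_extension e1E S1inf h1E h1r.
have /choice[f fP] : forall w, exists t, memb e2 t = H << map e2 w >>.
  by move=> w; apply: memb_surj => u /Hsub/sub_map_emb.
pose h2 : {linear {malg K[seq S2]} -> {malg K[seq S2]}} := lext f.
have H2 : forall t, H (memb e2 t) = memb e2 (h2 t).
  apply: (malg_linP (f := H \o memb e2) (h := memb e2 \o h2)) => w /=.
  by rewrite membU -fP [h2 _]lextU.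
exists H, h2; split=> // [i j t|w u].
  by apply: (memb_inj e2E); rewrite (memb_xact e2E) -!H2 -HE (memb_xact e2E).
rewrite -(mcoeff_memb e2E) -H2 membU => /Hr.
by rewrite !size_map.
Qed.

End Transfer.

Lemma nat_infinite : infinite_alphabet nat.
Proof.
move=> s; exists (\max_(i <- s) i).+1; apply/negP => h.
by have := @leq_bigmax_seq _ s xpredT id _ h isT; rewrite ltnn.
Qed.

(** * The algebras [End_g(T^{<= r})] *)

Section TensorEndomorphisms.
Variables (K : fieldType) (Q : superform K nat).
Notation bar := (bar Q).
Notation eps := (eps Q).
Hypothesis par_const : forall i j, par Q i = par Q j.
Hypothesis nz2 : (2%:R : K) != 0.

(** The relation <X e_i, e_j> + <e_i, X e_j> = 0 in coordinates. *)
Definition form_inf (X : glinf K) : Prop :=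
  forall i j, X@_(bar j, i) * eps (bar j) + eps i * X@_(bar i, j) = 0.

Definition xmx i j : glinf K := << (i, j) >> + xcoef Q i j *: << (bar j, bar i) >>.

Lemma xpar_const i j : xpar Q i j = false.
Proof. by rewrite /xpar (par_const i j) addbb. Qed.

Lemma mcoeff_xmx i j k l :
  (xmx i j)@_(k, l) = (if (i == k) && (j == l) then 1 else 0) +
    (if (bar j == k) && (bar i == l) then xcoef Q i j else 0).
Proof.
rewrite mcoeffD mcoeffZ !mcoeffU !xpair_eqE.
by case: (_ && _); case: (_ && _); rewrite ?mulr1 ?mulr0.
Qed.

Lemma xmx_form_inf i j : form_inf (xmx i j).
Proof.
move=> k l; rewrite !mcoeff_xmx.
have := xcoef_inv1 Q i j; have := xcoef_inv2 Q i j.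
rewrite xpar_const /= !mul1r => c2 c1.
rewrite !(inj_eq (@bar_inj _ _ Q)) !bar_eq.
rewrite mulrDl mulrDr [eps k * _ + _]addrC addrACA [X in X + _](_ : _ = 0) ?add0r.
  rewrite [(i == bar k) && _]andbC; case: eqP => [<-|_]; last by rewrite mul0r mulr0 addr0.
  case: eqP => [ik|_]; last by rewrite mul0r mulr0 addr0.
  by rewrite c2 ik barK mulr1 addNr.
rewrite andbC; case: eqP => [<-|_]; last by rewrite mul0r mulr0 addr0.
case: eqP => [il|_]; last by rewrite mul0r mulr0 addr0.
by rewrite mul1r -il mulrC c1 subrr.
Qed.


(** The sum of the [X_ij x_ij] hits the entry (a, b) twice, through [x_ab] and through the second
    term of [x_ij] for (i, j) = ([bar b], [bar a]); by invariance both contributions equal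
    [X_ab]. *)
Lemma form_inf_decomp X : form_inf X ->
  2%:R *: X = lext (fun p => xmx p.1 p.2) X.
Proof.
move=> gX; apply/malgP => -[a b]; rewrite mcoeffZ mcoeff_lext.
have pick p (c : K) : \sum_(k <- msupp X) X@_k * (if k == p then c else 0) = X@_p * c.
  case: (msuppP X p) => [pX|pX]; last first.
    rewrite mul0r big1_seq // => k /andP[_ kX].
    by case: eqP kX pX => [->->|] //; rewrite mulr0.
  rewrite (big_fsetD1 p) //= eqxx big1_fset ?addr0 // => k.
  by rewrite !inE => /andP[/negbTE-> _] _; rewrite mulr0.
rewrite (eq_bigr (fun k => X@_k * (if k == (a, b) then 1 else 0) + X@_k *
    (if k == (bar b, bar a) then xcoef Q (bar b) (bar a) else 0))) => [|[i j] _]; last first.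
  rewrite mcoeff_xmx mulrDr !xpair_eqE !bar_eq [(j == _) && _]andbC; congr (_ + _ * _).
  by case: eqP => [->|] //; case: eqP => [->|].
rewrite big_split /=.
rewrite !pick mulr1 mulr_natl mulr2n; congr (_ + _).
have := gX (bar a) b; rewrite barK => /eqP; rewrite addrC addr_eq0 => /eqP e.
have ea := eps_neq0 Q (bar a); apply: (mulfI ea); rewrite e /xcoef xpar_const /= mul1r.
by field.
Qed.


Lemma act_linearX c X Y t : act (c *: X + Y) t = c *: act X t + act Y t :> tensV K.
Proof.
have natactP j : natact (c *: X + Y) << j >> = c *: natact X << j >> + natact Y << j >>.
  apply/malgP => i; rewrite mcoeff_natact [LHS]mcoeffD mcoeffZ.
  by rewrite [RHS]mcoeffD mcoeffZ !mcoeff_natact.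
apply: (malg_linP (f := act (c *: X + Y))
  (h := [the {linear tensV K -> tensV K} of (c \*: act X) \+ act Y])) => w.
rewrite /= !act_basis /act_word scaler_sumr -big_split /=; apply: eq_bigr => k _.
by rewrite natactP linearP tensPr tensPl.
Qed.

Lemma act_0X t : act 0 t = 0 :> tensV K.
Proof. by have := act_linearX (-1) 0 0 t; rewrite scaler0 addr0 scaleN1r addNr. Qed.

Lemma act_cons X a w : act X << a :: w >> =
  tens (inV (natact X << a >>)) << w >> + lcons a (act X << w >>) :> tensV K.
Proof.
rewrite -cat1s act_tensUU -inVU act_inV; congr (_ + _).
apply: (malg_linP (f := tens (inV << a >>)) (h := lcons a)) => v /=.
by rewrite inVU tensUU /lcons lextU.
Qed.

(** On an alphabet of constant parity every [x_ij] is even, so the super action is the ordinary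
    Leibniz action, even when all letters are odd. *)
Lemma act_xmx i j t : act (xmx i j) t = xact Q i j t.
Proof.
apply: (malg_linP (f := act (xmx i j)) (h := xact Q i j)) => w /=.
rewrite xactU; elim: w => [|a w IHw]; first by rewrite act_one.
rewrite act_cons IHw /= xpar_const scale1r; congr (_ + _).
have -> : natact (xmx i j) << a >> = (if a == j then << i >> else 0) +
    (if a == bar i then xcoef Q i j *: << bar j >> else 0) :> natV K.
  apply/malgP => k; rewrite mcoeff_natact mcoeff_xmx mcoeffD.
  rewrite [in RHS](fun_if (mcoeff k)) [X in _ = _ + X](fun_if (mcoeff k)).
  rewrite mcoeffZ !mcoeffU !mcoeff0 (eq_sym a j) (eq_sym a).
  rewrite andbC; congr (_ + _); first by case: eqP => //; case: eqP.
  by rewrite andbC; case: eqP => //; case: eqP; rewrite ?mulr1 ?mulr0.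
have tU (b : nat) : tens (inV << b >>) << w >> = << b :: w >> :> tensV K.
  by rewrite inVU tensUU.
have tZ (c : K) (b : nat) (v : natV K) : tens (inV (c *: << b >> + v)) << w >> =
    c *: << b :: w >> + tens (inV v) << w >> :> tensV K.
  by rewrite linearP tensPl tU.
case: (a == j); case: (a == bar i).
- by rewrite addrC tZ tU addrC.
- by rewrite !addr0 tU.
- by rewrite !add0r -[_ *: _]addr0 tZ linear0 tens0l addr0.
- by rewrite !addr0 linear0 tens0l.
Qed.


Variable g : glinf K -> Prop.
Hypothesis gE : forall X, g X <-> form_inf X.

(** Extension by zero to longer words puts all levels [r] on one space, where by [opr_incl] the maps
    of the direct system become identities. *)
Definition opr r (h : endg g r) (t : tensV K) : tensV K := val (h (to_tle r t)).

Lemma opr_is_linear r (h : endg g r) : linear (opr h).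
Proof. by move=> c s t; rewrite /opr !linearP. Qed.

HB.instance Definition _ r (h : endg g r) :=
  GRing.isLinear.Build K (tensV K) (tensV K) *:%R (opr h) (opr_is_linear h).

Lemma opr_equivariant r (h : endg g r) : equivariant Q (opr h).
Proof.
move=> i j t; rewrite -!act_xmx /opr to_tle_act endg_equiv //.
by apply/gE/xmx_form_inf.
Qed.

Lemma opr_bounded r (h : endg g r) : bounded_op r (opr h).
Proof.
move=> w u; rewrite /opr; have [wr|wr] := leqP (size w) r; last first.
  have -> : to_tle r << w >> = 0 :> tle K r.
    by apply: val_inj; rewrite /= /trunc lextU leqNgt wr.
  by rewrite linear0 mcoeff0 eqxx.
have [//|ur] := leqP (size u) r.
by have /tleP -> := valP (h (to_tle r << w >>)); rewrite ?eqxx.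
Qed.

Lemma opr_inj r (h h' : endg g r) : (forall t, opr h t = opr h' t) -> h = h'.
Proof.
move=> e; apply: endg_ext => t; apply: val_inj.
have <- : to_tle r (val t) = t by apply: val_inj; rewrite to_tle_id.
exact: e.
Qed.

Lemma opr_lin r c (h h' : endg g r) t : opr (c *: h + h') t = c *: opr h t + opr h' t.
Proof. by []. Qed.

Lemma opr_mul r (h h' : endg_alg g r) t : opr (alg_mul h h') t = opr h (opr h' t).
Proof.
rewrite /opr /=; congr (val (h _)).
by apply: val_inj; rewrite to_tle_id.
Qed.

Lemma opr_incl r s (h : endg_alg g r) t :
  (r <= s)%N -> opr (endg_incl s h : endg g s) t = opr h t.
Proof.
move=> rs; rewrite /opr endg_inclE to_tle_id //; congr (val (h _)).
apply: val_inj; apply/malgP => w; rewrite /= !mcoeff_trunc.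
by case: ifP => // wr; rewrite (leq_trans wr rs).
Qed.

Lemma opr_surj r (h : {linear tensV K -> tensV K}) :
  equivariant Q h -> bounded_op r h -> exists h' : endg g r, forall t, opr h' t = h t.
Proof.
move=> hE hr.
have hact X t : g X -> h (act X t) = act X (h t).
  move=> /gE/form_inf_decomp decX.
  (* Equivariance holds first for 2X, a combination of the [x_ij]; the factor 2 is cancelled
     afterwards. *)
  have hx : h (act (2%:R *: X) t) = act (2%:R *: X) (h t).
    rewrite decX lextE.
    elim/big_rec: _ => [|[i j] Y _ IHY].
      by rewrite !act_0X linear0.
    rewrite 2!act_linearX -IHY (act_xmx i j t) (act_xmx i j (h t)) -hE.
    exact: linearP.
  have act2 s : act (2%:R *: X) s = 2%:R *: act X s.
    by rewrite -[_ *: X]addr0 act_linearX act_0X addr0.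
  by move: hx; rewrite !act2 linearZ => /(scalerI nz2).
(* Since [h] is bounded by [r], the truncation of its output loses nothing. *)
have h'P : (fun t : tle K r => to_tle r (h (val t))) \in @endg_pred K g r.
  apply/asboolP; split=> [c s t|X gX t]; first by rewrite !linearP.
  by rewrite /= hact // to_tle_act.
exists (EndG h'P); apply: (malg_linP (f := opr (EndG h'P)) (h := h)) => w.
have trU : val (to_tle r << w >>) = if (size w <= r)%N then << w >> else 0 :> tensV K.
  by rewrite /= /trunc lextU.
rewrite -[LHS]/(val (to_tle r (h (val (to_tle r << w >>))))) trU.
apply/malgP => u; rewrite mcoeff_trunc.
have [wr|wr] := leqP (size w) r; last first.
  rewrite linear0 mcoeff0 if_same; apply/esym/eqP.
  by apply: contraTT wr => /hr[]; rewrite -leqNgt.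
case: ifP => // /negbT; apply: contraNeq.
by rewrite eq_sym => /hr[].
Qed.

End TensorEndomorphisms.

(** * Passage to the limit *)

Section DirectLimits.
Variables (K : fieldType) (D E : dirSys K).
Variable rel : forall n, D n -> E n -> Prop.
Hypothesis rel_lin : forall n c a a' b b', @rel n a b -> @rel n a' b' ->
  @rel n (c *: a + a') (c *: b + b').
Hypothesis rel_mul : forall n a a' b b', @rel n a b -> @rel n a' b' ->
  @rel n (alg_mul a a') (alg_mul b b').
Hypothesis rel_map : forall n m a b, (n <= m)%N -> @rel n a b ->
  @rel m (ds_map D n m a) (ds_map E n m b).
Hypothesis rel_total : forall n a, exists b, @rel n a b.
Hypothesis rel_surj : forall n b, exists a, @rel n a b.
Hypothesis rel_0l : forall n b, @rel n 0 b -> b = 0.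
Hypothesis rel_0r : forall n a, @rel n a 0 -> a = 0.

Let relim (x : dirlim_alg D) (y : dirlim_alg E) : Prop :=
  exists n a b, [/\ @rel n a b, x = dl_in a & y = dl_in b].

Lemma dl_in_eq0 (F : dirSys K) n (a : F n) : dl_in a = 0 :> dirlim_alg F ->
  exists2 m, (n <= m)%N & ds_map F n m a = 0.
Proof.
rewrite -[0]/(dl_zero F) (dl_zeroE F n) => /dl_in_eq[m [nm _]].
by rewrite ds_map0 // => e; exists m.
Qed.

Lemma dl_in0 (F : dirSys K) n : dl_in (0 : F n) = 0 :> dirlim_alg F.
Proof. exact/esym/dl_zeroE. Qed.

Let relim_common x y x' y' : relim x y -> relim x' y' ->
  exists n a b a' b', [/\ @rel n a b, @rel n a' b' &
    [/\ x = dl_in a, y = dl_in b, x' = dl_in a' & y' = dl_in b']].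
Proof.
move=> [n [a [b [ab -> ->]]]] [m [a' [b' [ab' -> ->]]]].
have nM := leq_maxl n m; have mM := leq_maxr n m; set M := maxn n m in nM mM.
exists M, (ds_map D n M a), (ds_map E n M b), (ds_map D m M a'), (ds_map E m M b').
by split; [exact: rel_map | exact: rel_map | rewrite !dl_in_map].
Qed.

Let relim_lin c x y x' y' : relim x y -> relim x' y' ->
  relim (c *: x + x') (c *: y + y').
Proof.
move=> xy xy'; have [n [a [b [a' [b' [ab ab' [-> -> -> ->]]]]]]] := relim_common xy xy'.
exists n, (c *: a + a'), (c *: b + b'); split; first exact: rel_lin.
  by have [h _] := dl_in_hom D n; rewrite h.
by have [h _] := dl_in_hom E n; rewrite h.
Qed.

Let relim_mul x y x' y' : relim x y -> relim x' y' ->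
  relim (alg_mul x x') (alg_mul y y').
Proof.
move=> xy xy'; have [n [a [b [a' [b' [ab ab' [-> -> -> ->]]]]]]] := relim_common xy xy'.
exists n, (alg_mul a a'), (alg_mul b b'); split; first exact: rel_mul.
  by have [_ h] := dl_in_hom D n; rewrite h.
by have [_ h] := dl_in_hom E n; rewrite h.
Qed.

Let relim_0l y : relim 0 y -> y = 0.
Proof.
move=> [n [a [b [ab /esym/dl_in_eq0[m nm a0] ->]]]].
have := rel_map nm ab; rewrite a0 => /rel_0l b0.
by rewrite -(dl_in_map b nm) b0 dl_in0.
Qed.

Let relim_0r x : relim x 0 -> x = 0.
Proof.
move=> [n [a [b [ab -> /esym/dl_in_eq0[m nm b0]]]]].
have := rel_map nm ab; rewrite b0 => /rel_0r a0.
by rewrite -(dl_in_map a nm) a0 dl_in0.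
Qed.

(** In the limit, the relation is the graph of the isomorphism: linearity and trivial kernels on
    both sides give uniqueness by subtraction, totality on both sides gives the two maps by
    choice. *)
Lemma dirlim_iso : alg_iso (dirlim_alg D) (dirlim_alg E).
Proof.
have uniqr x y y' : relim x y -> relim x y' -> y = y'.
  move=> xy xy'; have := relim_lin (-1) xy xy'; rewrite !scaleN1r addNr => /relim_0l/eqP.
  by rewrite addrC subr_eq0 => /eqP ->.
have uniql x x' y : relim x y -> relim x' y -> x = x'.
  move=> xy xy'; have := relim_lin (-1) xy xy'; rewrite !scaleN1r addNr => /relim_0r/eqP.
  by rewrite addrC subr_eq0 => /eqP ->.
have /choice[f fP] x : exists y, relim x y.
  have [n [a ->]] := dl_in_surj x; have [b ab] := rel_total a.
  by exists (dl_in b), n, a, b.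
have /choice[h hP] y : exists x, relim x y.
  have [n [b ->]] := dl_in_surj y; have [a ab] := rel_surj b.
  by exists (dl_in a), n, a, b.
exists f; split; first split.
- by move=> c x x'; apply: uniqr (fP _) (relim_lin _ (fP _) (fP _)).
- by move=> x x'; apply: uniqr (fP _) (relim_mul (fP _) (fP _)).
exists h => [x|y]; first exact: uniql (hP _) (fP _).
exact: uniqr (fP _) (hP _).
Qed.

End DirectLimits.

(** * Isomorphism through common extensions *)

Section EndomorphismAlgebras.
Variables (K : fieldType) (L : choiceType).
Variables (Q1 Q2 : superform K nat) (QL : superform K L) (e1 e2 : nat -> L).
Variables (g1 g2 : glinf K -> Prop).
Hypothesis (e1E : form_embedding Q1 QL e1) (e2E : form_embedding Q2 QL e2).
Hypothesis par1 : forall i j, par Q1 i = par Q1 j.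
Hypothesis par2 : forall i j, par Q2 i = par Q2 j.
Hypothesis nz2 : (2%:R : K) != 0.
Hypothesis g1E : forall X, g1 X <-> form_inf Q1 X.
Hypothesis g2E : forall X, g2 X <-> form_inf Q2 X.

(* Common extension to the words in [L]. *)
Definition twin r (h1 : endg g1 r) (h2 : endg g2 r) : Prop :=
  exists H : {linear {malg K[seq L]} -> {malg K[seq L]}},
  [/\ equivariant QL H, forall t, H (memb e1 t) = memb e1 (opr h1 t) &
    forall t, H (memb e2 t) = memb e2 (opr h2 t)].

Lemma opr_eq0 (g : glinf K -> Prop) r (h : endg g r) : (forall t, opr h t = 0) -> h = 0.
Proof. by move=> h0; apply: opr_inj => t; rewrite h0. Qed.

(** [twin] is total on both sides by [operator_transfer], used in both directions, and has trivial
    kernels because restriction from [L] is injective. *)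
Lemma A_alg_iso : alg_iso (A_alg g1) (A_alg g2).
Proof.
apply: (@dirlim_iso K (endg_sys g1) (endg_sys g2) twin).
- move=> r c h1 h1' h2 h2' [H [HE H1 H2]] [H' [HE' H1' H2']].
  exists [the {linear {malg K[seq L]} -> {malg K[seq L]}} of (c \*: H) \+ H'].
  split=> [i j t|t|t]; rewrite ?opr_lin /=.
  + by rewrite HE HE' linearP.
  + by rewrite H1 H1' linearP.
  + by rewrite H2 H2' linearP.
- move=> r h1 h1' h2 h2' [H [HE H1 H2]] [H' [HE' H1' H2']].
  exists [the {linear {malg K[seq L]} -> {malg K[seq L]}} of H \o H'].
  split=> [i j t|t|t]; rewrite ?opr_mul /=.
  + by rewrite HE' HE.
  + by rewrite H1' H1.
  + by rewrite H2' H2.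
- move=> r s h1 h2 rs [H [HE H1 H2]]; exists H; split=> // t.
  + by rewrite H1 opr_incl.
  + by rewrite H2 opr_incl.
- move=> r h1.
  have [H [h2 [HE h2E h2r H1 H2]]] := operator_transfer e1E e2E nat_infinite
    (opr_equivariant par1 g1E h1) (@opr_bounded _ _ _ h1).
  have [h2' h2'E] := opr_surj par2 nz2 g2E h2E h2r.
  by exists h2', H; split=> // t; rewrite H2 h2'E.
- move=> r h2.
  have [H [h1 [HE h1E h1r H2 H1]]] := operator_transfer e2E e1E nat_infinite
    (opr_equivariant par2 g2E h2) (@opr_bounded _ _ _ h2).
  have [h1' h1'E] := opr_surj par1 nz2 g1E h1E h1r.
  by exists h1', H; split=> // t; rewrite H1 h1'E.
(* A twin [H] of 0 vanishes on the words of the first alphabet, hence everywhere by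
   [equivariant_eq0]. *)
- move=> r h2 [H [HE H1 H2]]; apply: opr_eq0 => t; apply: (memb_inj e2E).
  rewrite -H2 linear0; apply: (equivariant_eq0 e1E nat_infinite HE) => w.
  by rewrite -membU H1 linear0.
- move=> r h1 [H [HE H1 H2]]; apply: opr_eq0 => t; apply: (memb_inj e1E).
  rewrite -H1 linear0; apply: (equivariant_eq0 e2E nat_infinite HE) => w.
  by rewrite -membU H2 linear0.
Qed.

End EndomorphismAlgebras.

(** * The orthogonal and symplectic forms *)

Section OrthogonalSymplectic.
Variable K : fieldType.

Definition o_form : superform K nat :=
  @Superform K nat (fun=> false) id (fun=> 1) (fun=> erefl) (fun=> erefl)
    (fun=> oner_neq0 K) (fun=> erefl).

(** Exchanges the two indices 2k and 2k+1 of a block of the symplectic form. *)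
Definition flip (i : nat) : nat := if odd i then i.-1 else i.+1.

Definition sp_sign (i : nat) : K := if odd i then -1 else 1.

Lemma odd_flip i : odd (flip i) = ~~ odd i.
Proof.
rewrite /flip; case: (boolP (odd i)) => [|/negbTE e]; last by rewrite /= e.
by case: i => //= i /negbTE.
Qed.

Lemma flip_eq k l : (k == flip l) = if odd k then k == l.+1 else l == k.+1.
Proof.
by rewrite /flip; case: (boolP (odd k)); case: (boolP (odd l)) => ol ok;
  apply/eqP/eqP => e; lia.
Qed.

Lemma flipK : involutive flip.
Proof.
by move=> i; rewrite {1}/flip odd_flip /flip; case: (boolP (odd i)) => //=; case: i.
Qed.

Lemma sp_sign_neq0 i : sp_sign i != 0.
Proof. by rewrite /sp_sign; case: (odd i); rewrite ?oppr_eq0 oner_neq0. Qed.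

Lemma sp_sign_flip i : sp_sign (flip i) = - sp_sign i.
Proof. by rewrite /sp_sign odd_flip; case: (odd i); rewrite /= ?opprK. Qed.

(** All letters are odd, which makes the alternating form supersymmetric. *)
Definition sp_form : superform K nat :=
  @Superform K nat (fun=> true) flip sp_sign flipK (fun=> erefl)
    sp_sign_neq0 sp_sign_flip.

Section Sum.
Variables (L1 L2 : choiceType) (Q1 : superform K L1) (Q2 : superform K L2).
Implicit Type a : (L1 + L2)%type.

Definition sum_par a := match a with inl x => par Q1 x | inr y => par Q2 y end.
Definition sum_bar a : L1 + L2 :=
  match a with inl x => inl (bar Q1 x) | inr y => inr (bar Q2 y) end.
Definition sum_eps a := match a with inl x => eps Q1 x | inr y => eps Q2 y end.

Lemma sum_barK : involutive sum_bar.
Proof. by case=> a /=; rewrite barK. Qed.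
Lemma sum_par_bar a : sum_par (sum_bar a) = sum_par a.
Proof. by case: a => a; exact: par_bar. Qed.
Lemma sum_eps_neq0 a : sum_eps a != 0.
Proof. by case: a => a; exact: eps_neq0. Qed.
Lemma sum_eps_bar a :
  sum_eps (sum_bar a) = if sum_par a then - sum_eps a else sum_eps a.
Proof. by case: a => a; exact: eps_bar. Qed.

Definition sum_form : superform K (L1 + L2)%type :=
  Superform sum_barK sum_par_bar sum_eps_neq0 sum_eps_bar.

Lemma inl_embedding : form_embedding Q1 sum_form inl.
Proof. by split=> // a b []. Qed.
Lemma inr_embedding : form_embedding Q2 sum_form inr.
Proof. by split=> // a b []. Qed.

End Sum.

Lemma glinf_bounded (X : glinf K) : exists n, forall i j,
  X@_(i, j) != 0 -> (i < n)%N && (j < n)%N.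
Proof.
exists (\max_(p <- msupp X) maxn p.1 p.2).+1 => i j; rewrite mcoeff_neq0 => h.
have := @leq_bigmax_seq _ (enum_fset (msupp X)) xpredT (fun p => maxn p.1 p.2) _ h isT.
by rewrite geq_max !ltnS.
Qed.

Lemma ulc_bounded n (X : glinf K) :
  (forall i j, X@_(i, j) != 0 -> (i < n)%N && (j < n)%N) ->
  ulc (\matrix_(i < n, j < n) X@_(val i, val j)) = X.
Proof.
move=> hX; apply/malgP => -[i j].
have [/andP[ni nj]|nij] := boolP ((i < n)%N && (j < n)%N).
  by rewrite (mcoeff_ulcE _ ni nj) mxE.
rewrite mcoeff_ulc_out; last by move: nij; rewrite negb_and -!leqNgt.
by apply/esym/eqP; apply: contraNT nij => /hX.
Qed.

Lemma o_infE (X : glinf K) : o_inf X <-> form_inf o_form X.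
Proof.
split=> [[n [A [hA ->]]] i j|hX].
  rewrite /= mulr1 mul1r.
  have [ni|ni] := ltnP i n; last by rewrite !mcoeff_ulc_out ?ni ?orbT // addr0.
  have [nj|nj] := ltnP j n; last by rewrite !mcoeff_ulc_out ?nj ?orbT // addr0.
  rewrite !mcoeff_ulcE.
  by have /matrixP/(_ (Ordinal ni) (Ordinal nj)) := hA; rewrite !mxE => ->; rewrite addNr.
have [n nX] := glinf_bounded X; exists n, (\matrix_(i < n, j < n) X@_(val i, val j)).
rewrite ulc_bounded //; split=> //; apply/matrixP => i j; rewrite !mxE.
have := hX (val i) (val j); rewrite /= mulr1 mul1r => /eqP.
by rewrite addr_eq0 => /eqP.
Qed.

Lemma flip_lt n i : (flip i < n.*2)%N = (i < n.*2)%N.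
Proof.
suff flt k : (k < n.*2)%N -> (flip k < n.*2)%N.
  by apply/idP/idP => /flt //; rewrite flipK.
rewrite /flip; case: (boolP (odd k)) => ok; first by case: k ok => //= k _ /ltnW.
by rewrite leq_eqVlt => /predU1P[e|//]; have := odd_double n; rewrite -e /= ok.
Qed.

(** Each row and column of [symp_mx] has a single nonzero entry, at the flipped index, so both
    matrix products collapse to one term. *)
Lemma sp_entry n (A : 'M[K]_(n.*2)) (i j : 'I_(n.*2)) :
  (A^T *m symp_mx K n.*2 + symp_mx K n.*2 *m A) i j =
  (ulc A)@_(flip j, val i) * sp_sign (flip j) +
  sp_sign i * (ulc A)@_(flip i, val j).
Proof.
have JE (k l : 'I_(n.*2)) : symp_mx K n.*2 k l =
    if val k == flip l then sp_sign k else 0.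
  by rewrite mxE flip_eq /sp_sign; case: (odd k) => //=; rewrite if_same.
have flt (k : 'I_n.*2) : (flip k < n.*2)%N by rewrite flip_lt.
have ulcE (k l : 'I_n.*2) : A k l = (ulc A)@_(val k, val l) by rewrite mcoeff_ulc.
rewrite [LHS]mxE; congr (_ + _); rewrite mxE.
  rewrite (bigD1 (Ordinal (flt j))) //= big1 => [|k /eqP kj].
    by rewrite mxE JE eqxx addr0 ulcE.
  rewrite JE; case: eqP => [e|_]; last by rewrite mulr0.
  by case: kj; apply: val_inj.
rewrite (bigD1 (Ordinal (flt i))) //= big1 => [|k /eqP ki].
  by rewrite JE /= flipK eqxx addr0 ulcE.
rewrite JE; case: eqP => [e|_]; last by rewrite mul0r.
by case: ki; apply: val_inj; rewrite /= e flipK.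
Qed.

Lemma sp_infE (X : glinf K) : sp_inf X <-> form_inf sp_form X.
Proof.
split=> [[n [A [hA ->]]] i j|hX].
  rewrite /=.
  have [ni|ni] := ltnP i n.*2; last first.
    by rewrite !mcoeff_ulc_out ?ni ?orbT // 1?leqNgt ?flip_lt -?leqNgt ?ni // mul0r mulr0 addr0.
  have [nj|nj] := ltnP j n.*2; last first.
    by rewrite !mcoeff_ulc_out ?nj ?orbT // 1?leqNgt ?flip_lt -?leqNgt ?nj // mul0r mulr0 addr0.
  by have := sp_entry A (Ordinal ni) (Ordinal nj); rewrite hA mxE => <-.
have [m mX] := glinf_bounded X.
(* The bound is doubled because the corners of sp have even size. *)
have nX i j : X@_(i, j) != 0 -> (i < m.*2)%N && (j < m.*2)%N.
  by move=> /mX; lia.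
exists m, (\matrix_(i < m.*2, j < m.*2) X@_(val i, val j)).
rewrite ulc_bounded //; split=> //; apply/matrixP => i j.
by rewrite sp_entry ulc_bounded // mxE; exact: hX.
Qed.

End OrthogonalSymplectic.

Theorem corollary6p10 (R : realType) :
  alg_iso (A_alg (@sp_inf R[i])) (A_alg (@o_inf R[i])).
Proof.
pose QL := sum_form (o_form R[i]) (sp_form R[i]).
(* The symplectic alphabet is the odd, right-hand summand of [QL]. *)
apply: (A_alg_iso (QL := QL) (inr_embedding _ _) (inl_embedding _ _)) => //.
- by rewrite Num.Theory.pnatr_eq0.
- exact: sp_infE.
- exact: o_infE.
Qed.
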